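(* Let $G$ be a finitely presented, weakly parafree group with $b_1(G) > 1$. Then $G$ is large.
   Context: $b_1(G)$ denotes the first Betti number of $G$ (the rank of $H_1(G;\mathbb{Z})$). $\gamma_i(\cdot)$ denotes the $i$th term of the lower central series ($\gamma_1(G)=G$, $\gamma_{i+1}(G)=[\gamma_i(G),G]$). A group $G$ is weakly parafree if there is some non-trivial free group $F$ and, for each positive integer $i$, an isomorphism $F/\gamma_i(F)\to G/\gamma_i(G)$, such that these isomorphisms are compatible, i.e. they commute with the natural quotient maps $F/\gamma_{i}(F)\to F/\gamma_{i-1}(F)$ and $G/\gamma_{i}(G)\to G/\gamma_{i-1}(G)$ for all $i\ge 2$. A group is large if it has a finite index subgroup that admits a surjective homomorphism onto a free non-abelian group. *)

(* Defs.v *)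
From HB Require Import structures.
From mathcomp Require Import all_boot ssralg ssrint.
From mathcomp Require Import boolp classical_sets cardinality.

Set Implicit Arguments.
Unset Strict Implicit.
Unset Printing Implicit Defensive.

Local Open Scope group_scope.
Local Open Scope classical_set_scope.
Local Open Scope quotient_scope.

(* Groups are inhabitants of mathcomp's [groupType], which need not be finite.
   Between groups, a magma morphism [{multiplicative G -> H}] is the same thing
   as a group homomorphism. *)

Section Subgroups.
Variable G : groupType.
Implicit Types (A B H N : set G).

Definition is_subgroup H : Prop := group_closed [pred x | x \in H].

Definition is_normal N : Prop :=
  is_subgroup N /\ forall x g, N x -> N (x ^ g).

Definition generated_subgroup A : set G := smallest is_subgroup A.

Definition normal_closure_set A : set G := smallest is_normal A.

Definition commutator_subgroup A B : set G :=
  generated_subgroup [set [~ x, y] | x in A & y in B].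

Lemma is_subgroupP H :
  is_subgroup H <-> H 1 /\ forall x y, H x -> H y -> H (x / y).
Proof.
split=> [[H1 Hd]|[H1 Hd]].
  split=> [|x y Hx Hy]; first by move: H1; rewrite !inE.
  by have := Hd x y; rewrite !inE; apply.
split=> [|x y]; first by rewrite !inE.
by rewrite !inE => Hx Hy; exact: Hd.
Qed.

Lemma is_subgroupV H x : is_subgroup H -> H x -> H x^-1.
Proof. by case/is_subgroupP=> H1 Hd Hx; rewrite -[_^-1]mul1g; apply: Hd. Qed.

Lemma is_subgroupM H x y : is_subgroup H -> H x -> H y -> H (x * y).
Proof.
move=> sH Hx Hy; rewrite -[y]invgK.
by case/is_subgroupP: (sH) => _; apply => //; apply: is_subgroupV.
Qed.

Lemma generated_is_subgroup A : is_subgroup (generated_subgroup A).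
Proof.
apply/is_subgroupP; split=> [H /= [/is_subgroupP[H1 _] _] //|x y gx gy H /= HA].
by case: (HA) => /is_subgroupP[_ Hd] _; apply: Hd; [apply: gx|apply: gy].
Qed.

Lemma normal_closure_normal A : is_normal (normal_closure_set A).
Proof.
split=> [|x g nx H /= HA]; last by case: (HA) => -[_ Hj] _; apply: Hj; apply: nx.
apply/is_subgroupP; split=> [H /= [[/is_subgroupP[H1 _] _] _] //|x y gx gy H /= HA].
by case: (HA) => -[/is_subgroupP[_ Hd] _] _; apply: Hd; [apply: gx|apply: gy].
Qed.

Lemma commutator_normal A B : is_normal A -> is_normal B ->
  is_normal (commutator_subgroup A B).
Proof.
move=> [_ nA] [_ nB]; split=> [|x g]; first exact: generated_is_subgroup.
have sP : is_subgroup [set x | commutator_subgroup A B (x ^ g)].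
  have /is_subgroupP[C1 Cd] :=
    generated_is_subgroup [set [~ x, y] | x in A & y in B].
  apply/is_subgroupP; split=> [|u v Cu Cv]; first by rewrite /= conj1g.
  by rewrite /= conjMg conjVg; apply: Cd.
apply: (smallest_sub sP) => _ [a Aa [b Bb <-]] /=; rewrite conjRg.
by apply: sub_gen_smallest; exists (a ^ g); [apply: nA|exists (b ^ g); [apply: nB|]].
Qed.

Record normal_subgroup := NormalSubgroup {
  normal_set :> set G;
  normal_setP : is_normal normal_set
}.

Definition normal_closure A : normal_subgroup :=
  NormalSubgroup (normal_closure_normal A).

(* [lcs_set i] is the i-th term for i >= 1; the value at 0 is a dummy. *)
Fixpoint lcs_set (i : nat) : set G :=
  if i is (j.+1 as i').+1 then commutator_subgroup (lcs_set i') setT else setT.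

Lemma lcs_normal i : is_normal (lcs_set i).
Proof.
have nT : is_normal setT by split=> //; apply/is_subgroupP.
by case: i => [//|i]; elim: i => [//|i IHi]; apply: commutator_normal.
Qed.

Definition gamma (i : nat) : normal_subgroup := NormalSubgroup (lcs_normal i).

End Subgroups.

Arguments gamma : clear implicits.

Lemma gamma1 (G : groupType) : gamma G 1 = setT :> set G.
Proof. by []. Qed.

Lemma gammaS (G : groupType) i :
  gamma G i.+2 = commutator_subgroup (gamma G i.+1) setT :> set G.
Proof. by []. Qed.

Lemma gamma_sub (G : groupType) i : gamma G i.+2 `<=` gamma G i.+1.
Proof.
have [sN nN] := normal_setP (gamma G i.+1).
apply: smallest_sub => // _ [x Nx [y _ <-]].
by apply: is_subgroupM => //; [apply: is_subgroupV|apply: nN].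
Qed.

Section SubgroupType.
Variables (G : groupType) (H : set G) (sH : is_subgroup H).

(* [H] as a group in its own right; the proof that [H] is a subgroup is
   recorded in the type so that the group structure can be inferred from it. *)
Definition subgroup_type of is_subgroup H : Type := {x : G | x \in H}.
HB.instance Definition _ := SubChoice.on (subgroup_type sH).
HB.instance Definition _ :=
  SubChoice_isSubGroup.Build G _ (subgroup_type sH) sH.

End SubgroupType.

Section Quotient.
Variables (G : groupType) (N : normal_subgroup G).

Definition lcoset_eq (x y : G) : bool := x^-1 * y \in normal_set N.

Lemma lcoset_eqE x y : lcoset_eq x y = `[< normal_set N (x^-1 * y) >].
Proof. by apply/idP/asboolP; rewrite /lcoset_eq inE. Qed.

Lemma lcoset_eq_equiv : equiv_class_of lcoset_eq.
Proof.
have [sN _] := normal_setP N; have [N1 _] := (is_subgroupP _).1 sN.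
split=> [x|x y|y x z]; rewrite !lcoset_eqE.
- by apply/asboolP; rewrite mulVg.
- by apply/asboolP/asboolP => /(is_subgroupV sN); rewrite invgM invgK.
- move=> /asboolP Nxy /asboolP Nyz; apply/asboolP.
  by have := is_subgroupM sN Nxy Nyz; rewrite mulgA mulgK.
Qed.

Canonical lcoset_eq_equiv_rel := EquivRelPack lcoset_eq_equiv.

Definition group_quotient : Type := {eq_quot lcoset_eq}.
HB.instance Definition _ : EqQuotient G lcoset_eq group_quotient :=
  EqQuotient.on group_quotient.
HB.instance Definition _ := Choice.on group_quotient.

Lemma quotient_eqP (x y : G) :
  \pi_group_quotient x = \pi_group_quotient y <-> normal_set N (x^-1 * y).
Proof.
split=> [/eqP|Nxy]; first by rewrite piE lcoset_eqE => /asboolP.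
by apply/eqP; rewrite piE lcoset_eqE; apply/asboolP.
Qed.

Lemma quotient_ind (P : group_quotient -> Prop) :
  (forall x, P (\pi_group_quotient x)) -> forall a, P a.
Proof. by move=> Ppi a; rewrite -[a]reprK. Qed.

Definition quotient_one : group_quotient := \pi_group_quotient 1.
Definition quotient_mul (a b : group_quotient) : group_quotient :=
  \pi_group_quotient (repr a * repr b).
Definition quotient_inv (a : group_quotient) : group_quotient :=
  \pi_group_quotient (repr a)^-1.

Lemma repr_pi (x : G) : normal_set N ((repr (\pi_group_quotient x))^-1 * x).
Proof. by apply/quotient_eqP; rewrite reprK. Qed.

Lemma quotient_mulE (x y : G) :
  quotient_mul (\pi_group_quotient x) (\pi_group_quotient y) =
  \pi_group_quotient (x * y).
Proof.
have [sN nN] := normal_setP N; apply/quotient_eqP.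
have Nx := repr_pi x; have Ny := repr_pi y.
have := is_subgroupM sN (nN _ (repr (\pi_group_quotient y)) Nx) Ny.
by rewrite /conjg invgM !mulgA mulgK.
Qed.

Lemma quotient_invE (x : G) :
  quotient_inv (\pi_group_quotient x) = \pi_group_quotient x^-1.
Proof.
have [sN nN] := normal_setP N; apply/quotient_eqP; rewrite invgK.
have := nN _ x^-1 (is_subgroupV sN (repr_pi x)).
by rewrite /conjg invgM !invgK !mulgA mulgV mul1g.
Qed.

Lemma quotient_mulA : associative quotient_mul.
Proof.
elim/quotient_ind=> x; elim/quotient_ind=> y; elim/quotient_ind=> z.
by rewrite !quotient_mulE mulgA.
Qed.
Lemma quotient_mul1g : left_id quotient_one quotient_mul.
Proof. by elim/quotient_ind=> x; rewrite quotient_mulE mul1g. Qed.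
Lemma quotient_mulg1 : right_id quotient_one quotient_mul.
Proof. by elim/quotient_ind=> x; rewrite quotient_mulE mulg1. Qed.
Lemma quotient_mulVg : left_inverse quotient_one quotient_inv quotient_mul.
Proof. by elim/quotient_ind=> x; rewrite quotient_invE quotient_mulE mulVg. Qed.
Lemma quotient_mulgV : right_inverse quotient_one quotient_inv quotient_mul.
Proof. by elim/quotient_ind=> x; rewrite quotient_invE quotient_mulE mulgV. Qed.

HB.instance Definition _ := isGroup.Build group_quotient quotient_mulA
  quotient_mul1g quotient_mulg1 quotient_mulVg quotient_mulgV.

Lemma quotient_piM : {morph \pi_group_quotient : x y / x * y >-> x * y}.
Proof. by move=> x y; rewrite -quotient_mulE. Qed.

HB.instance Definition _ :=
  isMultiplicative.Build G group_quotient \pi_group_quotient quotient_piM.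

End Quotient.

(* The natural map G / N -> G / M, meaningful when N is contained in M. *)
Definition quotient_map (G : groupType) (N M : normal_subgroup G)
  (c : group_quotient N) : group_quotient M := \pi_(group_quotient M) (repr c).

Arguments quotient_map {G} N M c.

Lemma quotient_mapE (G : groupType) (N M : normal_subgroup G) (x : G) :
  (N : set G) `<=` M ->
  quotient_map N M (\pi_(group_quotient N) x) = \pi_(group_quotient M) x.
Proof. by move=> NM; apply/quotient_eqP/NM/repr_pi. Qed.

Section Homology.
Variable G : groupType.

(* H_1(G; Z), i.e. the abelianization G / [G, G], written additively. *)
Definition homology1 : Type := group_quotient (gamma G 2).
HB.instance Definition _ := Choice.on homology1.

Lemma homology1_mulC : commutative (@quotient_mul G (gamma G 2)).
Proof.
elim/quotient_ind=> x; elim/quotient_ind=> y; rewrite !quotient_mulE.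
apply/quotient_eqP.
apply: sub_gen_smallest; exists y => //; exists x => //.
by rewrite /commg /conjg invgM !mulgA.
Qed.

HB.instance Definition _ := GRing.isZmodule.Build homology1
  (@quotient_mulA G (gamma G 2)) homology1_mulC
  (@quotient_mul1g G (gamma G 2)) (@quotient_mulVg G (gamma G 2)).

End Homology.

Definition Z_independent (A : zmodType) (n : nat) (a : 'I_n -> A) : Prop :=
  forall z : 'I_n -> int,
    (\sum_(i < n) a i *~ z i)%R = 0%R -> forall i, z i = 0%R.

(* The maximal size of a Z-independent family. When there is no maximum the
   value is the dummy 0; this does not occur for
   finitely generated groups. *)
Definition Z_rank (A : zmodType) : nat :=
  xget 0%N [set n : nat | (exists a : 'I_n -> A, Z_independent a) /\
    forall (m : nat) (a : 'I_m -> A), Z_independent a -> (m <= n)%N].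

Definition b1 (G : groupType) : nat := Z_rank (homology1 G).

(* Universal property: every map from X to a group extends uniquely to a
   homomorphism on F (only the values of f on X matter). *)
Definition free_on (F : groupType) (X : set F) : Prop :=
  forall (H : groupType) (f : F -> H),
    (exists g : {multiplicative F -> H}, forall x, X x -> g x = f x) /\
    (forall g h : {multiplicative F -> H},
      (forall x, X x -> g x = f x) -> (forall x, X x -> h x = f x) -> g =1 h).

Definition is_free (F : groupType) : Prop := exists X : set F, free_on X.

Definition nontrivial (G : groupType) : Prop := exists x : G, x <> 1.

Definition is_abelian (G : groupType) : Prop := forall x y : G, x * y = y * x.

Definition finitely_presented (G : groupType) : Prop :=
  exists (F : groupType) (X R : set F),
    [/\ free_on X, finite_set X, finite_set R &
        exists f : {multiplicative group_quotient (normal_closure R) -> G},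
          bijective f].

Definition weakly_parafree (G : groupType) : Prop :=
  exists F : groupType, [/\ is_free F, nontrivial F &
    exists phi : forall i : nat,
        {multiplicative group_quotient (gamma F i.+1) ->
                        group_quotient (gamma G i.+1)},
      (forall i, bijective (phi i)) /\
      (forall i (c : group_quotient (gamma F i.+2)),
        phi i (quotient_map (gamma F i.+2) (gamma F i.+1) c) =
        quotient_map (gamma G i.+2) (gamma G i.+1) (phi i.+1 c))].

Definition finite_index (G : groupType) (H : set G) : Prop :=
  finite_set [set [set x * h | h in H] | x in [set: G]].

Definition large (G : groupType) : Prop :=
  exists (H : set G) (sH : is_subgroup H) (F : groupType)
      (f : {multiplicative subgroup_type sH -> F}),
    [/\ finite_index H, is_free F, ~ is_abelian F &
        forall y : F, exists x, f x = y].

(* Main.v *)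
Require Import Defs.
From HB Require Import structures.
From mathcomp Require Import all_boot all_order all_algebra zify.
From mathcomp Require Import boolp classical_sets cardinality.

(**
Let F be the free group of the definition of a weakly parafree group G. Lifting
the isomorphism F / gamma_2(F) -> G / gamma_2(G) gives a homomorphism
theta : F -> G which generates G modulo commutators and satisfies
theta^-1(gamma_i(G)) = gamma_i(F) for all i ([weakly_parafree_morphism]). Hence G
is generated by theta(F) and finitely many elements g_1, ..., g_m, each of which
is a product of commutators of words w_j in the generators; and since the first
Betti number exceeds 1, a basis of F has at least two elements.

The relations g_j = w_j alone define a group E that maps onto G. The group E has
at least two generators more than relations, so the argument of Baumslag and
Pride applies to it. It yields a homomorphism from E to the wreath product W of
the free group Phi of rank 2 with a cyclic group of order n ([baumslag_pride]):
one basis element t goes around the cycle, and the images of the other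
generators are vectors of powers of one generator of Phi, whose exponents solve a
system of linear equations with more unknowns than equations. The preimage of
the base group then maps onto Phi.

It remains to see that this homomorphism factors through G. All lower central
quotients of E and of G are those of F, so the kernel of E -> G lies in every
term of the lower central series of E ([parafree_kernel_sub],
[parafree_extension]). It therefore dies in W if W is residually nilpotent. This
holds when n is a power of 2, because Phi can be realized as Sanov's group of
integer matrices congruent to 1 modulo 2 ([sanov_basis]) and a cyclic 2-group
acts unipotently in characteristic 2 ([wreath_residually_nilpotent]).

The group E is never built. Homomorphisms out of G are obtained as subgroups of
product groups ([graph_morphism]), and elements of the free group on the
generators are replaced by words, evaluated in whatever group is at hand.
*)

Set Implicit Arguments.
Unset Strict Implicit.
Unset Printing Implicit Defensive.

Import Order.TTheory GRing.Theory Num.Theory.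
Local Open Scope group_scope.
Local Open Scope classical_set_scope.
Local Open Scope quotient_scope.

(** * Homomorphisms, lower central series and words *)

Lemma is_subgroup1 (G : groupType) (H : set G) : is_subgroup H -> H 1.
Proof. by case/is_subgroupP. Qed.

Section Morphisms.
Variables (G H : groupType) (f : {multiplicative G -> H}).

Lemma gmorph1 : f 1 = 1.
Proof. by apply: (@mulgI _ (f 1)); rewrite -gmulfM !mulg1. Qed.

Lemma gmorphV x : f x^-1 = (f x)^-1.
Proof. by apply/esym/mulg1_eq; rewrite -gmulfM mulgV gmorph1. Qed.

Lemma gmorphR x y : f [~ x, y] = [~ f x, f y].
Proof. by rewrite !gmulfM !gmorphV. Qed.

Lemma preimage_subgroup (K : set H) :
  is_subgroup K -> is_subgroup [set x | K (f x)].
Proof.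
move=> /is_subgroupP[K1 Kd]; apply/is_subgroupP; split=> [|x y Kx Ky] /=.
  by rewrite gmorph1.
by rewrite gmulfM gmorphV; apply: Kd.
Qed.

End Morphisms.

Lemma morphism_of (G H : groupType) (f : G -> H) :
  {morph f : x y / x * y} -> exists g : {multiplicative G -> H}, g =1 f.
Proof.
move=> fM; pose m := isMultiplicative.Build G H f fM.
by exists (HB.pack_for {multiplicative G -> H} f m).
Qed.

Lemma generated_eqT_ind (G : groupType) (A K : set G) :
  generated_subgroup A = setT -> is_subgroup K -> A `<=` K -> forall x, K x.
Proof.
move=> AT sK AK x; suff : generated_subgroup A `<=` K by apply; rewrite AT.
exact: smallest_sub.
Qed.

(** Values prescribed on generators are recorded as a subgroup of the product;
    they extend to a homomorphism as soon as the fibre over 1 is trivial. *)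
Lemma graph_morphism (G W : groupType) (S : set (G * W)) :
  is_subgroup S -> (forall g, exists w, S (g, w)) ->
  (forall w, S (1, w) -> w = 1) ->
  exists psi : {multiplicative G -> W}, forall g w, S (g, w) <-> psi g = w.
Proof.
move=> sS tS S1.
have [_ Sd] := (is_subgroupP S).1 sS.
have uS g w w' : S (g, w) -> S (g, w') -> w = w'.
  move=> Sw Sw'; have /= := Sd _ _ Sw Sw'.
  have -> : (g, w) / (g, w') = (1, w / w') :> G * W.
    by rewrite -[LHS]/(g / g, w / w') mulgV.
  by move=> /S1/divg1_eq.
pose f g := projT1 (cid (tS g)).
have Sf g : S (g, f g) by rewrite /f; case: cid.
have [psi psiE] : exists psi : {multiplicative G -> W}, psi =1 f.
  apply: morphism_of => x y; apply: uS (Sf _) _.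
  exact: (is_subgroupM sS (Sf x) (Sf y)).
by exists psi => g w; split=> [|<-]; rewrite psiE // => /(uS _ _ _ (Sf g)).
Qed.


(** Conjugation by [g] multiplies [x] by the central element [[~ x, g]], so
    conjugations by any two elements have the same effect on [x] in either
    order. *)
Lemma commute_commutator (G : groupType) (x : G) :
  (forall g h, commute [~ x, g] h) -> forall g h, commute x [~ g, h].
Proof.
move=> cx g h.
have xE y z : x ^ (y * z) = x * [~ x, z] * [~ x, y].
  rewrite conjgM [x ^ y](_ : _ = x * [~ x, y]); last by rewrite mulVKg.
  rewrite conjMg [x ^ z](_ : _ = x * [~ x, z]); last by rewrite mulVKg.
  by rewrite [[~ x, y] ^ z]conjgE (cx y z) mulKg.
apply/commgP; rewrite -conjg_fix.
have -> : [~ g, h] = (g^-1 * h^-1) * (h^-1 * g^-1)^-1.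
  by rewrite commgEl conjgE invgM !invgK !mulgA.
by rewrite conjgM (can2_eq (conjgK _) (conjgKV _)) invgK !xE -[X in X == _]mulgA cx mulgA.
Qed.

Notation lcs G i := (normal_set (gamma G i)).

Lemma commgMl_central (G : groupType) (x y z : G) :
  (forall g, commute z g) -> [~ x * z, y] = [~ x, y].
Proof.
move=> cz; rewrite -(cz x) !commgEl conjMg invgM.
by rewrite [z ^ y]conjgE (cz y) mulKg -mulgA mulKg.
Qed.

Lemma commgMr_central (G : groupType) (x y z : G) :
  (forall g, commute z g) -> [~ x, y * z] = [~ x, y].
Proof. by move=> cz; rewrite -invgR commgMl_central ?invgR. Qed.

Section LowerCentralSeries.
Variable G : groupType.
Implicit Types (x y g c d : G) (i : nat).

Lemma lcs_subgroup i : is_subgroup (lcs G i).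
Proof. by have [] := normal_setP (gamma G i). Qed.

Lemma lcsM i x y : lcs G i x -> lcs G i y -> lcs G i (x * y).
Proof. exact: is_subgroupM (lcs_subgroup i). Qed.

Lemma lcsV i x : lcs G i x -> lcs G i x^-1.
Proof. exact: is_subgroupV (lcs_subgroup i). Qed.

Lemma lcsR i x y : lcs G i.+1 x -> lcs G i.+2 [~ x, y].
Proof. by move=> gx; apply: sub_gen_smallest; exists x => //; exists y. Qed.

Lemma lcs_leq i j : (i <= j)%N -> lcs G j.+1 `<=` lcs G i.+1.
Proof.
move=> /subnK <-; elim: (j - i)%N => // k IH.
by rewrite addSn; apply: subset_trans IH; apply: gamma_sub.
Qed.

Lemma quotient_eq1 (N : normal_subgroup G) x :
  \pi_(group_quotient N) x = 1 <-> normal_set N x.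
Proof.
rewrite -[1]/(\pi_(group_quotient N) 1); split=> [/esym|Nx].
  by move=> /quotient_eqP; rewrite invg1 mul1g.
by apply/esym/quotient_eqP; rewrite invg1 mul1g.
Qed.

Lemma quotient_central i x (q : group_quotient (gamma G i.+2)) :
  lcs G i.+1 x -> commute (\pi_(group_quotient (gamma G i.+2)) x) q.
Proof.
move=> gx; elim/quotient_ind: q => y; apply/commgP/eqP.
by rewrite -gmorphR; apply/quotient_eq1; exact: lcsR.
Qed.

Lemma lcs_ind i (K : set G) :
  is_subgroup K -> (forall x y, lcs G i.+1 x -> K [~ x, y]) -> lcs G i.+2 `<=` K.
Proof.
by move=> sK KR; apply: smallest_sub => // _ [x gx [y _ <-]]; apply: KR.
Qed.

Lemma lcs2_ind (K : set G) :
  is_subgroup K -> (forall x y, K [~ x, y]) -> lcs G 2 `<=` K.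
Proof. by move=> sK KR; apply: lcs_ind => // x y _. Qed.

(** Modulo gamma_(i+3) every commutator with [x] is central, so [x] commutes with
    commutators. This is the case of the three subgroups lemma in which one of
    the groups is the whole group. *)
Lemma lcsR2 i x d : lcs G i.+1 x -> lcs G 2 d -> lcs G i.+3 [~ x, d].
Proof.
move=> gx; apply: (lcs2_ind (K := [set d | lcs G i.+3 [~ x, d]])).
  pose pi : {multiplicative G -> _} := \pi_(group_quotient (gamma G i.+3)).
  have KE y : lcs G i.+3 [~ x, y] <-> commute (pi x) (pi y).
    by rewrite -quotient_eq1 gmorphR; split=> [/eqP/commgP|/commgP/eqP].
  apply/is_subgroupP; split=> [|y z /KE cy /KE cz]; rewrite /mkset.
    by rewrite commg1; exact: (is_subgroup1 (lcs_subgroup _)).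
  by apply/KE; rewrite gmulfM gmorphV; apply/commuteM => //; apply/commuteV.
move=> g h; apply/quotient_eq1; rewrite !gmorphR; apply/eqP/commgP.
apply: (@commute_commutator (group_quotient _)); elim/quotient_ind=> y k; rewrite -gmorphR.
apply: quotient_central; exact: lcsR.
Qed.

End LowerCentralSeries.

Lemma morphism_lcs (G H : groupType) (f : {multiplicative G -> H}) i x :
  lcs G i x -> lcs H i (f x).
Proof.
case: i => [//|i]; elim: i => [//|i IH] in x *.
suff : lcs G i.+2 `<=` [set x | lcs H i.+2 (f x)] by apply.
apply: lcs_ind => [|c g gc]; first exact/preimage_subgroup/lcs_subgroup.
by rewrite /mkset gmorphR; apply: lcsR; exact: IH.
Qed.

(** The graded pieces of the lower central series are generated by commutators
    and so are functorial in the abelianization alone. *)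
Lemma morphism_lcs_congr (A B : groupType) (f f' : {multiplicative A -> B}) :
  (forall x, lcs B 2 ((f x)^-1 * f' x)) ->
  forall i x, lcs A i.+1 x -> lcs B i.+2 ((f x)^-1 * f' x).
Proof.
move=> ff'; elim=> [x _|i IH]; first exact: ff'.
pose pi : {multiplicative B -> _} := \pi_(group_quotient (gamma B i.+3)).
have KE x : lcs B i.+3 ((f x)^-1 * f' x) <-> pi (f x) = pi (f' x).
  by split=> [?|?]; apply/quotient_eqP.
suff : lcs A i.+2 `<=` [set x | lcs B i.+3 ((f x)^-1 * f' x)] by apply.
apply: lcs_ind => [|c g gc].
  apply/is_subgroupP; split=> [|x y /KE ex /KE ey].
    by apply/KE; rewrite !gmorph1.
  by apply/KE; rewrite !gmulfM !gmorphV ex ey.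
apply/KE; rewrite !gmorphR.
have [z -> gz] : exists2 z, f' c = f c * z & lcs B i.+2 z.
  by exists ((f c)^-1 * f' c); [rewrite mulVKg|exact: IH].
have [d -> gd] : exists2 d, f' g = f g * d & lcs B 2 d.
  by exists ((f g)^-1 * f' g); [rewrite mulVKg|exact: ff'].
have cz q : commute (pi z) q by apply: quotient_central.
have cd : commute (pi (f c)) (pi d).
  apply/commgP/eqP; rewrite -gmorphR; apply/quotient_eq1.
  by apply: lcsR2 gd; exact: morphism_lcs.
have cR q : commute [~ pi (f c), pi (f g)] q.
  by rewrite -gmorphR; apply: quotient_central; apply: lcsR; exact: morphism_lcs.
rewrite !gmulfM commgMl_central //.
set a := pi (f c) in cd cR *; set b := pi (f g) in cR *.
rewrite !commgEl conjgM [a ^ b](_ : _ = a * [~ a, b]); last by rewrite mulVKg.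
by rewrite conjMg [a ^ _]conjgE cd mulKg [_ ^ pi d]conjgE (cR (pi d)) !mulKg.
Qed.

(** A subgroup that generates modulo commutators generates modulo every term of
    the lower central series: if E = H gamma_i(E) then modulo gamma_(i+1)(E)
    every commutator of E is one of H. *)
Lemma generates_mod_lcs (F E : groupType) (h : {multiplicative F -> E}) :
  (forall e, exists v, lcs E 2 ((h v)^-1 * e)) ->
  forall i e, exists v, lcs E i.+1 ((h v)^-1 * e).
Proof.
move=> h2; elim=> [|i IH] e; first by exists 1.
pose pi : {multiplicative E -> _} := \pi_(group_quotient (gamma E i.+2)).
have [v0 hv0] := h2 e.
have [||v hv] := @lcs2_ind E [set d | exists v, pi (h v) = pi d] _ _ _ hv0.
- apply/is_subgroupP; split=> [|x y [v vx] [w wy]] /=; first by exists 1; rewrite gmorph1.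
  by exists (v / w); rewrite !gmulfM !gmorphV vx wy.
- move=> x y /=; have [v vx] := IH x; have [w wy] := IH y.
  exists [~ v, w]; rewrite !gmorphR.
  have [c -> gc] : exists2 c, x = h v * c & lcs E i.+1 c.
    by exists ((h v)^-1 * x); rewrite ?mulVKg.
  have [d -> gd] : exists2 d, y = h w * d & lcs E i.+1 d.
    by exists ((h w)^-1 * y); rewrite ?mulVKg.
  have cc q : commute (pi c) q by apply: quotient_central.
  have cd q : commute (pi d) q by apply: quotient_central.
  by rewrite !gmulfM commgMl_central // commgMr_central.
exists (v0 * v); apply/quotient_eqP; rewrite -/pi !gmulfM hv -gmulfM mulVKg.
by [].
Qed.

Definition word A := seq (A * bool).

Section Words.
Variable A : Type.
Implicit Types (w : word A).

Definition letter_eval (G : groupType) (e : A -> G) (x : A * bool) : G :=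
  if x.2 then (e x.1)^-1 else e x.1.

Definition word_eval (G : groupType) (e : A -> G) w : G :=
  foldr (fun x g => letter_eval e x * g) 1 w.

Definition letter_inv (x : A * bool) := (x.1, ~~ x.2).

Definition word_inv w : word A := rev (map letter_inv w).

Section Eval.
Variables (G : groupType) (e : A -> G).

Lemma letter_eval_inv x : letter_eval e (letter_inv x) = (letter_eval e x)^-1.
Proof. by case: x => a []; rewrite /letter_eval //= invgK. Qed.

Lemma word_eval_cat w1 w2 :
  word_eval e (w1 ++ w2) = word_eval e w1 * word_eval e w2.
Proof. by elim: w1 => [|x w1 IH] /=; rewrite ?mul1g // IH mulgA. Qed.

Lemma word_eval_inv w : word_eval e (word_inv w) = (word_eval e w)^-1.
Proof.
elim: w => [|x w IH] /=; first by rewrite invg1.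
rewrite /word_inv map_cons rev_cons -cats1 word_eval_cat IH /=.
by rewrite letter_eval_inv mulg1 invgM.
Qed.

Lemma word_eval1 a : word_eval e [:: (a, false)] = e a.
Proof. exact: mulg1. Qed.

Lemma word_eval_closed (K : set G) w :
  is_subgroup K -> (forall a, K (e a)) -> K (word_eval e w).
Proof.
move=> sK Ke; elim: w => [|[a b] w IH] /=; first exact: is_subgroup1.
apply: is_subgroupM => //; rewrite /letter_eval /=.
by case: b => //; apply: is_subgroupV.
Qed.

Lemma generated_words x :
  generated_subgroup (range e) x -> exists w, word_eval e w = x.
Proof.
apply: (smallest_sub (X := [set x | exists w, word_eval e w = x])).
  apply/is_subgroupP; split=> [|_ _ [w1 <-] [w2 <-]]; first by exists [::].
  by exists (w1 ++ word_inv w2); rewrite word_eval_cat word_eval_inv.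
by move=> _ [a _ <-]; exists [:: (a, false)]; rewrite word_eval1.
Qed.

End Eval.

Lemma morphism_word_eval (G H : groupType) (f : {multiplicative G -> H})
    (e : A -> G) w :
  f (word_eval e w) = word_eval (f \o e) w.
Proof.
elim: w => [|[a b] w IH] /=; first exact: gmorph1.
by rewrite gmulfM IH /letter_eval; case: b; rewrite //= gmorphV.
Qed.

(** Products of commutators are kept as words because the same word has to be
    evaluated in several groups at once. *)
Inductive commutator_word : word A -> Prop :=
| CommutatorNil : commutator_word [::]
| CommutatorCons w1 w2 w : commutator_word w ->
    commutator_word (word_inv w1 ++ word_inv w2 ++ w1 ++ w2 ++ w).

Lemma commutator_word_cat w1 w2 :
  commutator_word w1 -> commutator_word w2 -> commutator_word (w1 ++ w2).
Proof.
move=> c1 c2; elim: c1 => [//|u1 u2 u _ IH].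
by rewrite -!catA; apply: CommutatorCons.
Qed.

Lemma commutator_word_eval_cons (G : groupType) (e : A -> G) w1 w2 w :
  word_eval e (word_inv w1 ++ word_inv w2 ++ w1 ++ w2 ++ w) =
  [~ word_eval e w1, word_eval e w2] * word_eval e w.
Proof. by rewrite !word_eval_cat !word_eval_inv commgEl conjgE !mulgA. Qed.

Lemma commutator_word_lcs (G : groupType) (e : A -> G) w :
  commutator_word w -> lcs G 2 (word_eval e w).
Proof.
elim=> [|w1 w2 w' _ IH]; first exact: (is_subgroup1 (@lcs_subgroup G 2)).
by rewrite commutator_word_eval_cons; apply: lcsM => //; apply: lcsR.
Qed.

Lemma lcs_commutator_word (G : groupType) (e : A -> G) x :
  generated_subgroup (range e) = setT -> lcs G 2 x ->
  exists2 w, commutator_word w & word_eval e w = x.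
Proof.
move=> eT; have wP g : exists w, word_eval e w = g.
  by apply: generated_words; rewrite eT.
have Pw g h : exists2 w, commutator_word w & word_eval e w = [~ g, h].
  have [[w1 <-] [w2 <-]] := (wP g, wP h).
  exists (word_inv w1 ++ word_inv w2 ++ w1 ++ w2 ++ [::]).
    exact/CommutatorCons/CommutatorNil.
  by rewrite commutator_word_eval_cons mulg1.
suff Pw' w : commutator_word w ->
    exists2 w', commutator_word w' & word_eval e w' = (word_eval e w)^-1.
  apply: (lcs2_ind (K := [set x | exists2 w, commutator_word w & word_eval e w = x])).
    apply/is_subgroupP; split=> [|_ _ [w1 c1 <-] [w2 /Pw'[w c ew] <-]].
      by exists [::] => //; apply: CommutatorNil.
    by exists (w1 ++ w); [apply: commutator_word_cat|rewrite word_eval_cat ew].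
  exact: Pw.
elim=> [|w1 w2 w0 _ [w' c' e']]; first by exists [::]; rewrite ?invg1 //; apply: CommutatorNil.
rewrite commutator_word_eval_cons invgM invgR -e'.
have [w'' c'' <-] := Pw (word_eval e w2) (word_eval e w1).
by exists (w' ++ w''); [apply: commutator_word_cat|rewrite word_eval_cat].
Qed.

End Words.

(** * Wreath products and finite differences *)

Section Wreath.
Variables (Phi : groupType) (K : finZmodType).

Definition wreath : Type := ({ffun K -> Phi} * K)%type.
HB.instance Definition _ := Choice.on wreath.

Implicit Types x y : wreath.

Definition wreath_mul x y : wreath :=
  ([ffun k => x.1 k * y.1 (k + x.2)%R], (x.2 + y.2)%R).
Definition wreath_one : wreath := ([ffun=> 1], 0%R).
Definition wreath_inv x : wreath := ([ffun k => (x.1 (k - x.2)%R)^-1], (- x.2)%R).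

Lemma wreath_mulA : associative wreath_mul.
Proof.
move=> x y z; congr (_, _); last by rewrite /= addrA.
by apply/ffunP=> k; rewrite !ffunE /= mulgA addrA.
Qed.

Lemma wreath_mul1g : left_id wreath_one wreath_mul.
Proof.
move=> [f z]; congr (_, _); last by rewrite /= add0r.
by apply/ffunP=> k; rewrite !ffunE /= addr0 mul1g.
Qed.

Lemma wreath_mulg1 : right_id wreath_one wreath_mul.
Proof.
move=> [f z]; congr (_, _); last by rewrite /= addr0.
by apply/ffunP=> k; rewrite !ffunE /= mulg1.
Qed.

Lemma wreath_mulVg : left_inverse wreath_one wreath_inv wreath_mul.
Proof.
move=> [f z]; congr (_, _); last by rewrite /= addNr.
by apply/ffunP=> k; rewrite !ffunE /= mulVg.
Qed.

Lemma wreath_mulgV : right_inverse wreath_one wreath_inv wreath_mul.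
Proof.
move=> [f z]; congr (_, _); last by rewrite /= subrr.
by apply/ffunP=> k; rewrite !ffunE /= addrK mulgV.
Qed.

HB.instance Definition _ := isGroup.Build wreath
  wreath_mulA wreath_mul1g wreath_mulg1 wreath_mulVg wreath_mulgV.

Lemma wreath1E k : (1 : wreath).1 k = 1.
Proof. exact: ffunE. Qed.

Lemma wreathME x y k : (x * y).1 k = x.1 k * y.1 (k + x.2)%R.
Proof. exact: ffunE. Qed.

Lemma wreathVE x k : (x^-1).1 k = (x.1 (k - x.2)%R)^-1.
Proof. exact: ffunE. Qed.

Lemma wreath_shiftM x y : (x * y).2 = (x.2 + y.2)%R. Proof. by []. Qed.
Lemma wreath_shiftV x : (x^-1).2 = (- x.2)%R. Proof. by []. Qed.

Lemma wreath_eq x y : (forall k, x.1 k = y.1 k) -> x.2 = y.2 -> x = y.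
Proof.
by case: x y => [f z] [g w] /= fg ->; congr (_, _); apply/ffunP.
Qed.

Lemma wreath_shiftR x y : ([~ x, y]).2 = 0%R.
Proof.
by rewrite commgEl conjgE !wreath_shiftM !wreath_shiftV (addrC x.2) addKr addNr.
Qed.

Lemma wreath_conjE x y k : x.2 = 0%R ->
  ([~ x, y]).1 k =
  (x.1 k)^-1 * ((y.1 (k - y.2)%R)^-1 * x.1 (k - y.2)%R * y.1 (k - y.2)%R).
Proof.
move=> x0; rewrite commgEl conjgE !wreathME !wreathVE !wreath_shiftV x0.
by rewrite oppr0 !addr0 !mulgA.
Qed.

End Wreath.

Section FiniteDifferences.
Local Open Scope ring_scope.
Variables (n : nat) (R : zmodType).
Implicit Types (f g : {ffun 'Z_n -> R}) (z : 'Z_n).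

Definition shift z f : {ffun 'Z_n -> R} := [ffun k => f (k + z)].
Definition diff f : {ffun 'Z_n -> R} := shift 1 f - f.

Lemma shiftD z f g : shift z (f + g) = shift z f + shift z g.
Proof. by apply/ffunP=> k; rewrite !ffunE. Qed.

Lemma shiftN z f : shift z (- f) = - shift z f.
Proof. by apply/ffunP=> k; rewrite !ffunE. Qed.

Lemma shift_shift z w f : shift z (shift w f) = shift (z + w) f.
Proof. by apply/ffunP=> k; rewrite !ffunE addrA. Qed.

Lemma shift0 f : shift 0 f = f.
Proof. by apply/ffunP=> k; rewrite ffunE addr0. Qed.

Lemma diffD f g : diff (f + g) = diff f + diff g.
Proof. by rewrite /diff shiftD opprD addrACA. Qed.

Lemma diffN f : diff (- f) = - diff f.
Proof. by rewrite /diff shiftN opprD. Qed.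

Lemma diff_shift z f : diff (shift z f) = shift z (diff f).
Proof. by rewrite /diff shiftD shiftN !shift_shift addrC [_ + z]addrC addrC. Qed.

Lemma iter_diffD j f g : iter j diff (f + g) = iter j diff f + iter j diff g.
Proof. by elim: j => //= j ->; rewrite diffD. Qed.

Lemma iter_diffN j f : iter j diff (- f) = - iter j diff f.
Proof. by elim: j => //= j ->; rewrite diffN. Qed.

Lemma iter_diff_shift j z f : iter j diff (shift z f) = shift z (iter j diff f).
Proof. by elim: j => //= j ->; rewrite diff_shift. Qed.

(** T^z - 1 is a multiple of T - 1. *)
Lemma shift_sub_diff z f : exists g, shift z f - f = diff g.
Proof.
rewrite -[z]natr_Zp; elim: (z : nat) => [|m [g gE]].
  by exists 0; rewrite shift0 subrr /diff subr0; apply/ffunP=> k; rewrite !ffunE.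
exists (g + shift m%:R f); rewrite diffD -gE /diff shift_shift.
by rewrite -natr1 [1 + _]addrC [RHS]addrC addrA subrK.
Qed.

(** Modulo 2 the binomial formula gives (T - 1)^(2^m) = T^(2^m) - 1, where T is
    the translation by 1. *)
Lemma iter_diff_pow2 m f :
  exists g, iter (2 ^ m) diff f = shift (2 ^ m)%:R f - f + g *+ 2.
Proof.
elim: m f => [|m IH] f; first by exists 0; rewrite mul0rn addr0.
have [g gE] := IH f; have [h hE] := IH (iter (2 ^ m) diff f).
set T := shift (2 ^ m)%:R in gE hE.
exists ((f - T f) + (T g - g) + h).
have TD u v : T (u + v) = T u + T v by exact: shiftD.
rewrite expnS mul2n -addnn iterD hE gE natrD -shift_shift -/T !TD -/T.
have -> : T (- f) = - T f by exact: shiftN.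
set a := T (T f); set b := T f; set u := T g.
rewrite -mulr2n; move: (mulrnDl 2 (f - b + (u - g)) h) => ->.
rewrite [RHS]addrA; congr (_ + _).
move: (mulrnDl 2 (f - b) (u - g)) => ->; rewrite [RHS]addrA (mulrnBl 2 u).
rewrite opprD addrACA; congr (_ + _).
by rewrite mulr2n [RHS]addrA subrKA opprB.
Qed.

End FiniteDifferences.

(** * Residual nilpotence of wreath products *)

(** The values of [rho] are congruent to 1 modulo 2, so modulo 2 conjugation in
    the wreath product acts on first-order terms of base elements through the
    cyclic group of translations alone. In characteristic 2 a cyclic group of
    order 2^m acts unipotently, which is what makes the lower central series
    shrink. *)
Section ResidualNilpotence.
Variables (Phi : groupType) (R : pzRingType) (rho : Phi -> R).
Hypothesis rhoM : {morph rho : x y / x * y >-> (x * y)%R}.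
Hypothesis rho1 : rho 1 = 1%R.
Hypothesis rho_inj : injective rho.
Hypothesis rho_even : forall x, exists a, (rho x = 1 + a *+ 2)%R.
Hypothesis R_sep : forall a : R, (forall q, exists b, a = b *+ (2 ^ q))%R -> a = 0%R.
Variable m : nat.
Hypothesis m_gt0 : 0 < m.

Local Notation n := (2 ^ m)%N.
Local Notation W := (wreath Phi 'Z_n).
Local Notation fun_R := {ffun 'Z_n -> R}.

Section Even.
Local Open Scope ring_scope.

Definition even (V : zmodType) (a : V) := exists b, a = b *+ 2.

Lemma evenD (V : zmodType) (a b : V) : even a -> even b -> even (a + b).
Proof. by move=> [c ->] [d ->]; exists (c + d); rewrite mulrnDl. Qed.

Lemma evenN (V : zmodType) (a : V) : even a -> even (- a).
Proof. by move=> [c ->]; exists (- c); rewrite mulNrn. Qed.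

Lemma even_rhoMl x (a : R) : even (rho x * a - a).
Proof.
have [b ->] := rho_even x; exists (b * a).
by rewrite mulrDl mul1r addrC addKr mulrnAl.
Qed.

Lemma even_rhoMr x (a : R) : even (a * rho x - a).
Proof.
have [b ->] := rho_even x; exists (a * b).
by rewrite mulrDr mulr1 addrC addKr mulrnAr.
Qed.

Lemma even_ffun (f : fun_R) : (forall k, even (f k)) -> even f.
Proof.
move=> fE; exists [ffun k => projT1 (cid (fE k))].
by apply/ffunP=> k; rewrite mulr2n !ffunE -mulr2n; case: cid.
Qed.

End Even.

Section Filtration.
Local Open Scope ring_scope.

Definition diff_image j (b : fun_R) := exists c, even (b - iter j (@diff n R) c).

Lemma diff_imageD j b b' : diff_image j b -> diff_image j b' -> diff_image j (b + b').
Proof.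
move=> [c ec] [c' ec']; exists (c + c').
by rewrite iter_diffD opprD addrACA; apply: evenD.
Qed.

Lemma diff_imageN j b : diff_image j b -> diff_image j (- b).
Proof.
by move=> [c ec]; exists (- c); rewrite iter_diffN opprK addrC -opprB; apply: evenN.
Qed.

Lemma diff_image_even j b b' : even (b - b') -> diff_image j b' -> diff_image j b.
Proof.
by move=> e [c ec]; exists c; rewrite -(subrKA b'); apply: evenD.
Qed.

Lemma diff_image_shift j z b : diff_image j b -> diff_image j.+1 (shift z b - b).
Proof.
move=> [c [d dE]]; have [g gE] := shift_sub_diff z c; exists g.
rewrite iterSr -gE iter_diffD iter_diffN iter_diff_shift.
set C := iter j _ c in dE *; exists (shift z d - d).
have -> : b = C + d *+ 2 by rewrite -dE addrC subrK.
by rewrite shiftD opprD addrACA [X in X - _]addrC addrK mulrnBl !mulr2n shiftD.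
Qed.

Lemma diff_image_full b : diff_image n b -> even b.
Proof.
move=> [c e]; have [g gE] := iter_diff_pow2 m c.
rewrite -(subrK (iter n (@diff n R) c) b); apply: evenD => //; exists g.
rewrite gE (_ : n%:R = 0 :> 'Z_n) ?shift0 ?subrr ?add0r //.
by apply: pchar_Zp; rewrite -{1}(expn0 2) ltn_exp2l.
Qed.

(** The base elements 1 + 2^q b for which, modulo 2, [b] is in the image of
    (T - 1)^j. Taking a commutator with any element raises [j]
    ([wreath_filtration_comm]), and when [j] reaches [n] the factor (T - 1)^n
    vanishes modulo 2 and [q] can be raised. *)
Definition wreath_filtration q j : set W := [set x : W | x.2 = 0 /\
  exists2 b : fun_R, diff_image j b & forall k, rho (x.1 k) = 1 + b k *+ (2 ^ q)].

Lemma rhoV_congr q x (b : R) : rho x = 1 + b *+ (2 ^ q) ->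
  rho x^-1%g = 1 + (- (rho x^-1%g * b)) *+ (2 ^ q).
Proof.
move=> xb; have : rho x^-1%g * rho x = 1 by rewrite -rhoM mulVg.
rewrite {1}xb mulrDr mulr1 mulrnAr => /eqP; rewrite -[_ == 1]subr_eq0 => e.
by rewrite mulNrn; apply/eqP; rewrite -subr_eq0 opprD opprK addrA addrAC.
Qed.

Lemma wreath_filtration_subgroup q j : is_subgroup (wreath_filtration q j).
Proof.
apply/is_subgroupP; split=> [|x y [x0 [b ib bE]] [y0 [b' ib' bE']]].
  split=> //; exists 0; last by move=> k; rewrite wreath1E rho1 ffunE mul0rn addr0.
  set c := iter j (@diff n R) 0.
  have ic : diff_image j c by exists 0; exists 0; rewrite subrr mul0rn.
  by rewrite -(subrr c); apply: diff_imageD ic (diff_imageN ic).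
split; first by rewrite wreath_shiftM wreath_shiftV x0 y0 oppr0 addr0.
exists [ffun k => b k + rho (x.1 k) * - (rho (y.1 k)^-1%g * b' k)].
  apply: diff_image_even (diff_imageD ib (diff_imageN ib')).
  apply: even_ffun => k; rewrite !ffunE opprD addrACA subrr add0r opprK.
  set v := _ * b' k; rewrite -[X in X + _](subrK (- v)) -addrA.
  by apply: evenD; [exact: even_rhoMl|rewrite addrC -opprB; apply/evenN/even_rhoMl].
move=> k; rewrite wreathME wreathVE x0 y0 subr0 addr0 rhoM ffunE.
rewrite {1}(rhoV_congr (bE' k)) mulrDr mulr1 {1}bE mulrnAr mulrnDl.
by rewrite addrA.
Qed.

Lemma wreath_filtration_comm q j x y :
  wreath_filtration q j x -> wreath_filtration q j.+1 [~ x, y].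
Proof.
move=> [x0 [b ib bE]]; split; first exact: wreath_shiftR.
pose g k := y.1 (k - y.2).
exists [ffun k => - (rho (x.1 k)^-1%g * b k) +
          rho (x.1 k)^-1%g * (rho (g k)^-1%g * (b (k - y.2) * rho (g k)))].
  apply: diff_image_even (diff_image_shift (- y.2) ib).
  apply: even_ffun => k; rewrite !ffunE opprB addrACA.
  set u := (x.1 k)^-1%g; set v := (g k)^-1%g; set c := b (k - y.2).
  rewrite addrC; apply: evenD; last first.
    by rewrite addrC -opprB; apply/evenN/even_rhoMl.
  rewrite -(subrKA (rho v * (c * rho (g k)))) -(subrKA (c * rho (g k)) (rho v * _)).
  apply: evenD; first exact: even_rhoMl.
  by apply: evenD; [exact: even_rhoMl|exact: even_rhoMr].
move=> k; rewrite wreath_conjE // !rhoM ffunE bE -/(g k).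
rewrite mulrDr mulr1 mulrDl mulrnAr mulrnAl -mulrA -rhoM mulVg rho1.
rewrite mulrDr mulr1 {1}(rhoV_congr (bE k)) mulrnAr -addrA -mulrnDl.
by rewrite !mulrA.
Qed.

Lemma wreath_filtration_lcs1 : lcs W 2 `<=` wreath_filtration 1 0.
Proof.
move=> x gx; split.
  apply: (@lcs2_ind W [set x : W | x.2 = 0]) x gx; last exact: wreath_shiftR.
  apply/is_subgroupP; split=> // x y x0 y0.
  by rewrite /mkset wreath_shiftM wreath_shiftV x0 y0 oppr0 addr0.
exists [ffun k => projT1 (cid (rho_even (x.1 k)))].
  by eexists; exists 0; rewrite mul0rn /=; apply: subrr.
by move=> k; rewrite ffunE; case: cid.
Qed.

Lemma wreath_filtration_lcs q : exists i, lcs W i.+1 `<=` wreath_filtration q.+1 0.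
Proof.
elim: q => [|q [i iq]]; first by exists 1%N; exact: wreath_filtration_lcs1.
have ij j : lcs W (j + i).+1 `<=` wreath_filtration q.+1 j.
  elim: j => [//|j IH]; rewrite addSn; apply: lcs_ind.
    exact: wreath_filtration_subgroup.
  by move=> x y gx; apply: wreath_filtration_comm; apply: IH.
exists (n + i)%N => x /ij[x0 [b /diff_image_full[b' ->] bE]]; split=> //.
exists b'; first by exists b'; exists 0; rewrite subrr mul0rn.
by move=> k; rewrite bE mulr2n ffunE -mulr2n -mulrnA -expnS.
Qed.

End Filtration.

Lemma wreath_residually_nilpotent (x : W) : (forall i, lcs W i.+1 x) -> x = 1.
Proof.
move=> gx; apply: wreath_eq => [k|]; last first.
  by have [i iq] := wreath_filtration_lcs 0; have [] := iq _ (gx i).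
apply: rho_inj; rewrite wreath1E rho1; apply/eqP; rewrite -GRing.subr_eq0.
apply/eqP/R_sep => q; have [i /(_ _ (gx i))[_ [b _ bE]]] := wreath_filtration_lcs q.
by exists (b k *+ 2)%R; rewrite bE addrC addKr -mulrnA -expnS.
Qed.

End ResidualNilpotence.

(** * Free groups and Sanov's matrices *)

Section Reduced.
Variable A : eqType.
Implicit Types w : word A.

Definition reduced w := sorted (fun x y => y != letter_inv x) w.

(** The reduced form is common to all groups and all values of the letters. *)
Lemma reduce_word w : exists2 w', reduced w' &
  forall (G : groupType) (e : A -> G), word_eval e w' = word_eval e w.
Proof.
elim: w => [|x w [w' rw' ww']]; first by exists [::].
case: w' => [|y w'] in rw' ww' *.
  by exists [:: x] => // G e; rewrite /= -ww'.
case: (eqVneq y (letter_inv x)) => [yx|yx].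
  exists w' => [|G e]; first exact: path_sorted rw'.
  by rewrite /= -ww' /= yx letter_eval_inv mulVKg.
by exists [:: x, y & w'] => [|G e]; rewrite /= ?yx // -ww'.
Qed.

(** The pairs (e a, f (e a)) generate the graph of the required extension: an
    element over 1 is the value of a reduced word, which has to be empty. *)
Lemma free_on_reduced (F : groupType) (e : A -> F) :
  generated_subgroup (range e) = setT ->
  (forall w, reduced w -> word_eval e w = 1 -> w = [::]) ->
  free_on (range e).
Proof.
move=> eT e1 H f; split; last first.
  move=> g h gf hf x; have [w <-] : exists w, word_eval e w = x.
    by apply: generated_words; rewrite eT.
  rewrite !morphism_word_eval; congr word_eval; apply: funext => a /=.
  by rewrite gf ?hf.
pose d a : F * H := (e a, f (e a)).
have dE w : word_eval d w = (word_eval e w, word_eval (f \o e) w).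
  by rewrite [LHS]surjective_pairing; congr (_, _);
     rewrite morphism_word_eval.
have [||h hE|g gE] := @graph_morphism F H (generated_subgroup (range d)).
- exact: generated_is_subgroup.
- move=> x; have [w <-] : exists w, word_eval e w = x.
    by apply: generated_words; rewrite eT.
  exists (word_eval (f \o e) w); rewrite -dE.
  apply: (word_eval_closed w (generated_is_subgroup (range d))).
  by move=> a; apply: sub_gen_smallest; exists a.
- have [w wE] := generated_words hE.
  have [w' rw ww] := reduce_word w.
  have : word_eval d w' = (1, h) by rewrite ww.
  rewrite dE => -[/(e1 _ rw)-> <-].
  by [].
- exists g => _ [a _ <-]; apply/gE; apply: sub_gen_smallest.
  by exists a.
Qed.

End Reduced.

Section UnitGroup.
Variable R : unitRingType.

Definition unit_group : Type := {x : R | x \is a GRing.unit}.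
HB.instance Definition _ := SubChoice.on unit_group.

Definition unit_group_one : unit_group := Sub 1%R (unitr1 R).
Lemma unit_group_mul_subproof (x y : unit_group) :
  (val x * val y)%R \is a GRing.unit.
Proof. by rewrite unitrMl (valP x, valP y). Qed.

Lemma unit_group_inv_subproof (x : unit_group) : ((val x)^-1)%R \is a GRing.unit.
Proof. by rewrite unitrV (valP x). Qed.

Definition unit_group_mul (x y : unit_group) : unit_group :=
  Sub (val x * val y)%R (unit_group_mul_subproof x y).
Definition unit_group_inv (x : unit_group) : unit_group :=
  Sub (val x)^-1%R (unit_group_inv_subproof x).

Lemma unit_group_mulA : associative unit_group_mul.
Proof. by move=> x y z; apply: val_inj; rewrite /= mulrA. Qed.
Lemma unit_group_mul1g : left_id unit_group_one unit_group_mul.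
Proof. by move=> x; apply: val_inj; rewrite /= mul1r. Qed.
Lemma unit_group_mulg1 : right_id unit_group_one unit_group_mul.
Proof. by move=> x; apply: val_inj; rewrite /= mulr1. Qed.
Lemma unit_group_mulVg : left_inverse unit_group_one unit_group_inv unit_group_mul.
Proof. by move=> x; apply: val_inj; rewrite /= mulVr // (valP x). Qed.
Lemma unit_group_mulgV : right_inverse unit_group_one unit_group_inv unit_group_mul.
Proof. by move=> x; apply: val_inj; rewrite /= divrr // (valP x). Qed.

HB.instance Definition _ := isGroup.Build unit_group unit_group_mulA
  unit_group_mul1g unit_group_mulg1 unit_group_mulVg unit_group_mulgV.

End UnitGroup.

Section Sanov.
Local Open Scope ring_scope.

Definition elementary (i : bool) (a : int) : 'M[int]_2 :=
  1 + a *: (if i then delta_mx 1 0 else delta_mx 0 1).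

Lemma elementaryM i a b : elementary i a * elementary i b = elementary i (a + b).
Proof.
rewrite /elementary; set e := if i then _ else _.
have ee : e * e = 0 by rewrite /e; case: (i); apply: mul_delta_mx_0.
rewrite mulrDr mulr1 mulrDl mul1r -scalerAl -scalerAr ee !scaler0 addr0.
by rewrite -addrA -scalerDl.
Qed.

Lemma elementary0 i : elementary i 0 = 1.
Proof. by rewrite /elementary scale0r addr0. Qed.

Lemma elementary_unit i a : elementary i a \is a GRing.unit.
Proof.
apply/unitrP; exists (elementary i (- a)).
by rewrite !elementaryM addrN addNr elementary0.
Qed.

Definition sanov_gen (i : bool) : unit_group 'M[int]_2 :=
  Sub (elementary i 2) (elementary_unit i 2).

Lemma sanov_letter l : val (letter_eval sanov_gen l) =
  elementary l.1 (if l.2 then - 2 else 2).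
Proof.
case: l => i [] //=; rewrite /letter_eval /=.
rewrite -[RHS]mul1r -{1}(mulVr (elementary_unit i 2)) -mulrA elementaryM.
by rewrite subrr elementary0 mulr1.
Qed.

Definition action (M : 'M[int]_2) (v : int * int) : int * int :=
  (M 0 0 * v.1 + M 0 1 * v.2, M 1 0 * v.1 + M 1 1 * v.2).

Lemma actionM M N v : action (M * N) v = action M (action N v).
Proof.
rewrite /action !mxE !big_ord_recl !big_ord0 /=.
have -> : lift ord0 ord0 = 1 :> 'I_2 by apply: val_inj.
by congr (_, _); rewrite !addr0 !mulrDl !mulrDr !mulrA addrACA.
Qed.

Lemma action1 v : action 1 v = v.
Proof.
by rewrite [RHS]surjective_pairing /action !mxE /= !mul1r !mul0r addr0 add0r.
Qed.

Lemma action_elementary i a v : action (elementary i a) v =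
  if i then (v.1, v.2 + a * v.1) else (v.1 + a * v.2, v.2).
Proof.
rewrite /action /elementary !mxE; case: i; rewrite !mxE /=;
  by rewrite !(mulr0, mulr1, addr0, add0r, mul1r, mul0r) 1?addrC.
Qed.

(** The four ping-pong domains, one for each letter; together they make up the
    plane minus its axes and diagonals. *)
Definition cone (l : bool * bool) (v : int * int) : bool :=
  let: (a, b) := if l.1 then (v.2, v.1) else v in
  let b' := if l.2 then - b else b in
  (0 < b') && (b' < a) || (b' < 0) && (a < b').

Definition norm1 (v : int * int) : int := `|v.1| + `|v.2|.

(** The growth of the norm matters when a word begins and ends with the same
    letter: landing in the right cone would not then exclude a fixed vector. *)
Lemma ping_pong l l' v : l' != letter_inv l -> cone l' v ->
  cone l (action (val (letter_eval sanov_gen l)) v) /\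
  norm1 v < norm1 (action (val (letter_eval sanov_gen l)) v).
Proof.
rewrite sanov_letter action_elementary; case: v => x y.
by case: l l' => [[] []] [[] []] //= _; rewrite /cone /norm1 /=; lia.
Qed.

Lemma ping_pong_word l w v :
  path (fun x y => y != letter_inv x) l w -> cone (last l w) v ->
  cone l (action (val (word_eval sanov_gen (l :: w))) v) /\
  norm1 v < norm1 (action (val (word_eval sanov_gen (l :: w))) v).
Proof.
elim: w l => [|l' w IH] l.
  rewrite [word_eval _ _]mulg1 => _; apply: ping_pong.
  by case: l => i b; rewrite xpair_eqE eqxx /=; case: b.
rewrite /= => /andP[ll' lw] /(IH _ lw)[cw nw]; rewrite actionM.
have [cw' nw'] := ping_pong ll' cw.
by split=> //; apply: lt_trans nw nw'.
Qed.

Lemma cone_inhabited l : exists v, cone l v.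
Proof.
by case: l => [[] []]; [exists (- 1, 2)|exists (1, 2)|exists (2, - 1)|exists (2, 1)].
Qed.

Lemma sanov_reduced w : reduced w -> word_eval sanov_gen w = 1%g -> w = [::].
Proof.
case: w => [//|l w] rw e1; have [v cv] := cone_inhabited (last l w).
by have [_] := ping_pong_word rw cv; rewrite e1 action1 ltxx.
Qed.

Definition sanov : groupType :=
  subgroup_type (generated_is_subgroup (range sanov_gen)).

End Sanov.

Lemma subgroup_type_generated (G : groupType) (A : Type) (e : A -> G)
  (H := subgroup_type (generated_is_subgroup (range e))) :
  exists2 e' : A -> H, forall a, val (e' a) = e a &
    generated_subgroup (range e') = setT.
Proof.
have Ae a : e a \in generated_subgroup (range e).
  by rewrite inE; apply: sub_gen_smallest; exists a.
pose e' a : H := Sub (e a) (Ae a).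
exists e' => [a|]; first exact: SubK.
rewrite eqEsubset; split=> // x _.
have [w wx] : exists w, word_eval e w = val x.
  by apply: generated_words; have := valP x; rewrite inE.
have -> : x = word_eval e' w.
  apply: val_inj; rewrite -wx; elim: w {wx} => [|[a b] w IH] //=.
  by rewrite /= -IH; case: b.
apply: (word_eval_closed w (generated_is_subgroup (range e'))) => a.
by apply: sub_gen_smallest; exists a.
Qed.

Lemma sanov_basis : exists2 e : bool -> sanov, free_on (range e) &
  generated_subgroup (range e) = setT.
Proof.
have [e eE eT] := subgroup_type_generated sanov_gen; exists e => //.
apply: free_on_reduced eT _ => w rw /(congr1 val) e1; apply: sanov_reduced rw _.
apply: etrans e1; elim: w => [|[a b] w IH] //=.
by rewrite IH; case: b; rewrite /letter_eval /= eE.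
Qed.

Lemma sanov_nonabelian : ~ is_abelian sanov.
Proof.
move=> sC; have [e eE _] := subgroup_type_generated sanov_gen.
pose w : word bool := [:: (true, true); (false, true); (true, false); (false, false)].
suff /sanov_reduced : word_eval sanov_gen w = 1 by move=> /(_ isT).
have : word_eval e w = 1.
  rewrite /= /letter_eval /= mulg1 (mulgA (e false)^-1) (sC (e false)^-1).
  by rewrite -!mulgA mulVg mulg1 mulVg.
move=> /(congr1 val) w1; apply: etrans w1.
by rewrite /= /letter_eval /= !eE.
Qed.

Definition sanov_mx (x : sanov) : 'M[int]_2 := val (val x).

Lemma sanov_mx_even x : exists a, (sanov_mx x = 1 + a *+ 2)%R.
Proof.
pose K : set (unit_group 'M[int]_2) := [set y | exists a, (val y = 1 + a *+ 2)%R].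
suff KT : generated_subgroup (range sanov_gen) `<=` K.
  by apply: KT; have := valP x; rewrite inE.
apply: smallest_sub => [|_ [i _ <-]]; last first.
  exists (if i then delta_mx 1 0 else delta_mx 0 1)%R.
  by rewrite /= /elementary scaler_nat.
apply/is_subgroupP; split=> [|y z [a ya] [b zb]].
  by exists 0%R; rewrite mul0rn addr0.
have [c zc] : exists c, (val z^-1%g = 1 + c *+ 2)%R.
  exists (- (val z^-1%g * b))%R; rewrite mulNrn; apply/eqP.
  rewrite eq_sym subr_eq eq_sym; apply/eqP.
  have : (val z^-1%g * val z = 1)%R by apply: (mulVr (valP z)).
  by rewrite zb mulrDr mulr1 mulrnAr.
exists (a + c + a * (c *+ 2))%R.
have -> : val (y / z) = (val y * val z^-1%g)%R by [].
rewrite ya zc mulrDl mul1r mulrDr mulr1 mulrnAl !mulrnDl -addrA.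
by rewrite [(c *+ 2 + _)%R]addrCA !addrA.
Qed.

Lemma int_mx_separated (a : 'M[int]_2) :
  (forall q, exists b, a = b *+ (2 ^ q))%R -> a = 0%R.
Proof.
move=> aq; apply/matrixP=> i j; rewrite mxE; apply/eqP/negPn/negP=> aij.
have [b /matrixP/(_ i j)] := aq `|a i j|%N; rewrite mulmxnE => ab.
have := ltn_expl `|a i j|%N (isT : 1 < 2).
have : 2 ^ `|a i j| %| `|a i j|%N by rewrite {2}ab -mulr_natr natz abszM absz_nat dvdn_mull.
by move=> /dvdn_leq; rewrite absz_gt0 => /(_ aij); rewrite leqNgt => /negbTE->.
Qed.

Lemma sanov_wreath_residually_nilpotent m (x : wreath sanov 'Z_(2 ^ m)) :
  0 < m -> (forall i, lcs (wreath sanov 'Z_(2 ^ m)) i.+1 x) -> x = 1.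
Proof.
move=> m_gt0; apply: (@wreath_residually_nilpotent sanov _ sanov_mx) => //.
- by move=> y z /val_inj/val_inj.
- exact: sanov_mx_even.
- exact: int_mx_separated.
Qed.

(** * Unimodular kernels and integer powers *)

(** In the Smith normal form L D S of [M] the diagonal matrix D has a zero row,
    since [M] has more rows than columns. The row of L^-1 with the same index is
    annihilated by [M], and being a row of an invertible integer matrix it is
    unimodular: the column of L with that index provides [b]. *)
Lemma unimodular_kernel (I J : finType) (M : I -> J -> int) : #|J| < #|I| ->
  exists v b : I -> int, (forall j, (\sum_i v i * M i j)%R = 0%R) /\
    (\sum_i v i * b i)%R = 1%R.
Proof.
move=> JI; pose A := (\matrix_(i < #|I|, j < #|J|) M (enum_val i) (enum_val j))%R.
have [L uL [S uS [d _ AE]]] := int_Smith_normal_form A.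
pose r := Ordinal JI; pose V := invmx L.
exists (fun i => V r (enum_rank i)), (fun i => L (enum_rank i) r); split.
  move=> j; transitivity ((V *m A)%R r (enum_rank j)).
    rewrite mxE (reindex (@enum_rank I)) /=.
      by apply: eq_bigr => i _; rewrite [in RHS]mxE !enum_rankK.
    by apply: onW_bij; apply: enum_rank_bij.
  rewrite AE !mulmxA mulVmx // mul1mx mxE big1 // => i _.
  by rewrite mxE /= gtn_eqF ?mulr0n ?mul0r.
transitivity ((V *m L)%R r r); last by rewrite mulVmx // mxE eqxx.
by rewrite mxE (reindex (@enum_rank I)) //=; apply: onW_bij; apply: enum_rank_bij.
Qed.

Section IntegerPowers.
Variables (G : groupType) (x : G).

Definition expgz (z : int) : G := if z is Negz k then x ^- k.+1 else x ^+ `|z|%N.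

Lemma expgzB (i j : nat) : expgz (i%:Z - j%:Z)%R = x ^+ i / x ^+ j.
Proof.
case: (leqP j i) => ij.
  by rewrite subzn //= expgnFr.
have [k jE] : exists k, j = (i + k.+1)%N by exists (j - i).-1; lia.
rewrite jE (_ : (_ - _)%R = Negz k) /=; last by lia.
by rewrite addnC expgnDr invgM mulVKg.
Qed.

Lemma expgzD a b : expgz (a + b)%R = expgz a * expgz b.
Proof.
have zE (c : int) : exists i j : nat, c = (i%:Z - j%:Z)%R.
  by case: c => k; [exists k, 0%N|exists 0%N, k.+1]; lia.
have [i [j ->]] := zE a; have [k [l ->]] := zE b.
rewrite addrACA -opprD -!PoszD !expgzB !expgnDr invgM -!mulgA; congr (_ * _).
have c : commute (x ^+ j)^-1 (x ^+ k / x ^+ l).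
  apply/commute_sym/commuteV/commute_sym/commuteM; first exact: commuteX2.
  by apply/commuteV/commuteX2.
by rewrite c mulgA.
Qed.

Lemma expgzN a : expgz (- a)%R = (expgz a)^-1.
Proof. by apply/esym/mulg1_eq; rewrite -expgzD subrr. Qed.

End IntegerPowers.

(** * The Baumslag-Pride quotient *)

Lemma commutator_word_commute (A : Type) (G : groupType) (e : A -> G) w :
  (forall a a', commute (e a) (e a')) -> commutator_word w -> word_eval e w = 1.
Proof.
move=> ce; have cK (x : G) : is_subgroup [set y | commute x y].
  apply/is_subgroupP; split=> [|y z cy cz]; first exact: commute1.
  by apply: commuteM => //; apply: commuteV.
elim=> [//|w1 w2 w' _ IH]; rewrite commutator_word_eval_cons IH mulg1.
apply/eqP/commgP; apply: (word_eval_closed w2 (cK _)) => a.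
apply: commute_sym; apply: (word_eval_closed w1 (cK _)) => a'.
exact: ce.
Qed.

Section CyclicOrder.
Variable n : nat.
Hypothesis n_gt1 : 1 < n.
Implicit Types k q : 'Z_n.

Lemma Zp_ltn k : k < n.
Proof. by rewrite -{2}(Zp_cast n_gt1) ltn_ord. Qed.

Lemma val_Zp_succ k : (k + 1)%R = (if k.+1 == n then 0 else k.+1) :> nat.
Proof.
have kn := Zp_ltn k; rewrite -[k in LHS]natr_Zp natr1 val_Zp_nat //.
by case: eqP => [->|/eqP kn']; rewrite ?modnn // modn_small // ltn_neqAle kn'.
Qed.

(** The positions that a word of length at most [l] can visit when it starts
    from [k], each letter moving it by at most one step around the cycle. *)
Fixpoint near l k : set 'Z_n :=
  if l is l'.+1 then
    [set q | near l' k q \/ near l' (k + 1)%R q \/ near l' (k - 1)%R q]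
  else [set k].

Lemma near_refl l k : near l k k.
Proof. by elim: l => [//|l IH]; left. Qed.

Lemma near_interval (i j : nat) l k q :
  near l k q -> j < n -> i + l <= k -> k + l <= j -> i <= q <= j.
Proof.
elim: l k => [|l IH] k /=; first by move=> -> _; rewrite !addn0 => -> ->.
move=> kq jn ik kj; case: kq => [|[|]] /IH; apply => //; try lia.
- by rewrite val_Zp_succ; case: eqP; lia.
- by rewrite val_Zp_succ; case: eqP; lia.
- by have := val_Zp_succ (k - 1)%R; rewrite subrK; case: eqP; lia.
- by have := val_Zp_succ (k - 1)%R; rewrite subrK; case: eqP; lia.
Qed.

(** The distance to 0 on the cycle grows by at most one per step. *)
Lemma near_ends l k q :
  near l k q -> minn q (n - q) <= minn k (n - k) + l.
Proof.
elim: l k => [|l IH] k /=; first by move=> ->; rewrite addn0.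
case=> [/IH|[/IH|/IH]]; first lia.
- by rewrite val_Zp_succ; case: eqP; lia.
- have := val_Zp_succ (k - 1)%R; have := Zp_ltn (k - 1)%R.
  by rewrite subrK; case: eqP; lia.
Qed.

End CyclicOrder.

Section BasePower.
Variables (A : eqType) (x0 : A) (n : nat) (Phi : groupType).
Implicit Types (k q : 'Z_n) (s : 'Z_n -> Phi) (u : A -> 'Z_n -> Phi).

(** The letter [x0] moves around the cycle, picking up [s k] when it leaves the
    position [k]; every other letter stays in place and contributes its value at
    the current position. *)
Definition assign s u (a : A) : wreath Phi 'Z_n :=
  if a == x0 then ([ffun q => s q], 1%R) else ([ffun q => u a q], 0%R).

Definition letter_shift (x : A * bool) : 'Z_n :=
  (if x.1 == x0 then if x.2 then - 1 else 1 else 0)%R.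

Lemma assign_shift s u x : (letter_eval (assign s u) x).2 = letter_shift x.
Proof.
by case: x => a [];
  rewrite /letter_eval /letter_shift /assign /=; case: eqP => //= _; rewrite oppr0.
Qed.

Lemma assign_local s u s' u' l k w :
  (forall q, near l k q -> s q = s' q /\ forall a, u a q = u' a q) ->
  size w <= l -> (word_eval (assign s u) w).1 k = (word_eval (assign s' u') w).1 k.
Proof.
elim: w l k => [//|x w IH] [//|l] k nE; rewrite [size _]/= ltnS => sw.
rewrite [word_eval _ _]/(_ * _) [word_eval _ (_ :: _)]/(_ * _) !wreathME !assign_shift.
congr (_ * _); last first.
  apply: IH sw => q nq; apply: nE; rewrite /= /letter_shift in nq *.
  by case: ifP nq => _; [case: ifP => _; auto|rewrite addr0; auto].
have [nk nk'] : near l.+1 k k /\ near l.+1 k (k - 1)%R.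
  by split; [exact: near_refl|right; right; exact: near_refl].
have [[sk uk] [sk' _]] := (nE _ nk, nE _ nk').
case: x => a e; rewrite /letter_eval /assign /=.
by case: eqP => _; case: e; rewrite ?wreathVE /= ?subr0 !ffunE ?sk ?sk' ?uk.
Qed.

(** Powers of a single element commute. *)
Lemma assign_commutator s w : commutator_word w ->
  word_eval (assign s (fun _ _ => 1)) w = 1.
Proof.
apply: commutator_word_commute => a a'; rewrite /assign.
rewrite (_ : ([ffun=> 1], 0%R) = 1 :> wreath Phi 'Z_n) //.
by case: eqP => _; case: eqP => _ //; [apply: commute1|apply/commute_sym/commute1].
Qed.

(** When nothing is picked up by moving and all values are powers of one element
    [g], a word evaluates to a power of [g]. Its exponent depends linearly on the
    exponents of the letters, and this turns relations into linear equations. *)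
Fixpoint exponent (c : A -> 'Z_n -> int) w k : int :=
  if w is x :: w' then
    ((if x.1 == x0 then 0 else if x.2 then - c x.1 k else c x.1 k) +
     exponent c w' (k + letter_shift x))%R
  else 0%R.

Lemma assign_exponent (g : Phi) c w k :
  (word_eval (assign (fun=> 1) (fun a q => expgz g (c a q))) w).1 k =
  expgz g (exponent c w k).
Proof.
elim: w k => [|x w IH] k; first exact: wreath1E.
rewrite [word_eval _ _]/(_ * _) wreathME assign_shift IH [exponent _ _ _]/= expgzD.
congr (_ * _); case: x => a e; rewrite /letter_eval /assign /=.
by case: eqP => _; case: e; rewrite ?wreathVE /= ?subr0 !ffunE ?invg1 ?expgzN.
Qed.

Lemma exponent_sum (I : finType) (v : I -> int) (c : I -> A -> 'Z_n -> int) w k :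
  exponent (fun a q => \sum_i v i * c i a q)%R w k =
  (\sum_i v i * exponent (c i) w k)%R.
Proof.
elim: w k => [|x w IH] k /=; first by rewrite big1 // => i _; rewrite mulr0.
rewrite IH; under [in RHS]eq_bigr => i _ do rewrite mulrDr.
rewrite big_split /=; congr (_ + _)%R.
case: eqP => _; first by rewrite big1 // => i _; rewrite mulr0.
by case: x.2; rewrite // -sumrN; apply: eq_bigr => i _; rewrite mulrN.
Qed.

End BasePower.

(** The letter [x0] is sent to the generator of the cyclic group, with [e false]
    attached to the single step from position [n - 1] to position 0; the letters
    [y i] are sent to vectors of powers of [e true] that vanish at distance less
    than 2 L from position 0. A relator read from a position L <= k < n - L
    never takes the special step, and gives one linear equation between
    exponents. Read from any other position it only meets trivial
    vectors, and it dies because it is a product of commutators. There are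
    (m + 1)(n - 4 L) unknown exponents and only m (n - 2 L) equations, whence a
    unimodular solution once n is large; unimodularity makes [e true] itself
    appear in the image. *)
Section BaumslagPride.
Variables (A : eqType) (x0 : A) (m : nat) (y : 'I_m.+1 -> A).
Hypotheses (y_inj : injective y) (yx0 : forall i, y i != x0).
Variables (rel : 'I_m -> word A).
Hypothesis relC : forall j, commutator_word (rel j).
Variables (Phi : groupType) (e : bool -> Phi).
Hypothesis eT : generated_subgroup (range e) = setT.

Variables (L n : nat).
Hypothesis size_rel : forall j, size (rel j) < L.
Hypothesis n_big : L * (2 * m + 4) < n.

Hypothesis L_gt0 : 0 < L.

Let n_gt1 : 1 < n.
Proof. by apply: leq_ltn_trans n_big; rewrite muln_gt0 L_gt0 addn4. Qed.

Let I := ('I_m.+1 * 'I_(n - 4 * L))%type.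
Let J := ('I_m * 'I_(n - 2 * L))%type.

Let card_IJ : #|{: J}| < #|{: I}|.
Proof.
rewrite !card_prod !card_ord.
have : 4 * L <= n by have := n_big; nia.
have := n_big.
by move: n L => N l; nia.
Qed.

Let basis (i : I) (a : A) (q : 'Z_n) : int :=
  if (a == y i.1) && (q == 2 * L + i.2 :> nat) then 1%R else 0%R.

Let coef (v : I -> int) a q : int := (\sum_i v i * basis i a q)%R.

Let s (q : 'Z_n) := if q == n.-1 :> nat then e false else 1.
Let assignment (v : I -> int) : A -> wreath Phi 'Z_n :=
  assign x0 s (fun a q => expgz (e true) (coef v a q)).

Let coef0 v a (q : 'Z_n) : (q < 2 * L) || (n - 2 * L <= q) -> coef v a q = 0%R.
Proof.
move=> qL; apply: big1 => i _; rewrite /basis (_ : (q == _ :> nat) = false) ?andbF ?mulr0 //; apply/negbTE.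
by case: i => i1 [i2 /= i2n]; apply/eqP => qE; lia.
Qed.

Let relation_holds v :
  (forall j : J, \sum_i v i * (exponent x0 (basis i) (rel j.1) (L + j.2)%N%:R -
     basis i (y (lift ord0 j.1)) (L + j.2)%N%:R) = 0)%R ->
  forall j, word_eval (assignment v) (rel j) = assignment v (y (lift ord0 j)).
Proof.
move=> vP j.
apply: wreath_eq => [k|]; last first.
  have := @lcs2_ind (wreath Phi 'Z_n) [set x | x.2 = 0%R] _ _ _
    (commutator_word_lcs (assignment v) (relC j)).
  rewrite /assignment {3}/assign (negPf (yx0 _)) /=; apply; last exact: wreath_shiftR.
  apply/is_subgroupP; split=> // f g f0 g0.
  by rewrite /mkset wreath_shiftM wreath_shiftV f0 g0 oppr0 addr0.
rewrite [assignment v (y _)]/assignment /assign (negPf (yx0 _)) ffunE.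
have sL := size_rel j; have kn := Zp_ltn n_gt1 k.
have size_rel' : size (rel j) <= L.-1 by lia.
(* either the window of the relator avoids the special step, or it avoids the
   support of the exponents *)
case: (boolP ((L <= k) && (k < n - L))) => [/andP[Lk kL]|kL].
  rewrite (@assign_local _ x0 n Phi _ _ (fun=> 1)
    (fun a q => expgz (e true) (coef v a q)) L.-1) ?size_rel' //; last first.
    move=> q /(near_interval n_gt1 (i := 1) (j := n.-2)) qn; split=> //.
    rewrite /s; case: eqP => // qE; have := qn; rewrite qE; lia.
  rewrite assign_exponent exponent_sum; congr expgz; apply/eqP.
  have kJ : k - L < n - 2 * L by lia.
  have := vP (j, Ordinal kJ); rewrite /= subnKC // natr_Zp => /eqP.
  under eq_bigr => i _ do rewrite mulrBr.
  by rewrite sumrB subr_eq0.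
rewrite (@assign_local _ x0 n Phi _ _ s (fun _ _ => 1) L.-1) ?size_rel' //; last first.
  move=> q /(near_ends n_gt1) qn; split=> // a; rewrite coef0 //.
  by have := Zp_ltn n_gt1 q; lia.
rewrite assign_commutator // wreath1E coef0 //.
by lia.
Qed.

Let tX v k : ((assignment v x0) ^+ k).2 = k%:R%R.
Proof.
elim: k => [//|k IH]; rewrite expgSr wreath_shiftM IH /assignment /assign eqxx /=.
by rewrite natr1.
Qed.

Let tX1 v k : k < n -> ((assignment v x0) ^+ k).1 0%R = 1.
Proof.
elim: k => [|k IH] kn; first exact: wreath1E.
rewrite expgSr wreathME tX add0r IH ?mul1g; last exact: ltnW.
rewrite /assignment /assign eqxx ffunE /s val_Zp_nat // modn_small ?(ltnW kn) //.
by rewrite -eqSS (ltn_predK kn) ltn_eqF.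
Qed.

Let tXn v k : k = n -> ((assignment v x0) ^+ k).1 0%R = e false.
Proof.
case: k => [|k] kn; first by move: (n_gt1); rewrite {1}(esym kn).
have lt_kn : k < n by rewrite leq_eqVlt kn eqxx.
rewrite expgSr wreathME tX1 // mul1g tX add0r /assignment /assign eqxx ffunE /s.
by rewrite val_Zp_nat // modn_small // {1}(esym kn) eqxx.
Qed.

Let word_eval_nseq (G : groupType) (f : A -> G) k a :
  word_eval f (nseq k (a, false)) = f a ^+ k.
Proof. by elim: k => [//|k IH]; rewrite expgS -IH. Qed.

Let onto v (b : I -> int) : (\sum_i v i * b i = 1)%R ->
  forall z, exists2 w, (word_eval (assignment v) w).2 = 0%R &
    (word_eval (assignment v) w).1 0%R = z.
Proof.
move=> vb; pose Y : set Phi := [set z | exists2 w, (word_eval (assignment v) w).2 = 0%R &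
    (word_eval (assignment v) w).1 0%R = z].
have sY : is_subgroup Y.
  apply/is_subgroupP; split=> [|_ _ [w1 z1 <-] [w2 z2 <-]].
    by exists [::]; rewrite // wreath1E.
  exists (w1 ++ word_inv w2); rewrite word_eval_cat word_eval_inv.
    by rewrite wreath_shiftM wreath_shiftV z1 z2 subr0.
  by rewrite wreathME wreathVE z1 z2 subr0 addr0.
suff Ye : range e `<=` Y by move=> z; apply: generated_eqT_ind eT sY Ye z.
have YM a k : Y (expgz (e true) a) -> Y (expgz (e true) (a * k)%R).
  move=> Ya; have Yn l : Y (expgz (e true) (a * l%:Z)%R).
    elim: l => [|l IH]; first by rewrite mulr0; apply: is_subgroup1.
    by rewrite intS mulrDr mulr1 expgzD; apply: is_subgroupM.
  case: k => k //; rewrite NegzE mulrN expgzN; exact: is_subgroupV.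
have Yv i : Y (expgz (e true) (v i)).
  set p := (2 * L + i.2)%N; have pn : p < n by have := ltn_ord i.2; lia.
  pose w := nseq p (x0, false) ++ [:: (y i.1, false)] ++ word_inv (nseq p (x0, false)).
  have wE : word_eval (assignment v) w = assignment v x0 ^+ p * (assignment v (y i.1) * assignment v x0 ^- p).
    by rewrite !word_eval_cat word_eval_inv word_eval_nseq word_eval1.
  have y2 : (assignment v (y i.1)).2 = 0%R by rewrite /assignment /assign (negPf (yx0 _)).
  exists w; first by rewrite wE !wreath_shiftM wreath_shiftV tX y2 add0r subrr.
  rewrite wE !wreathME wreathVE tX y2 tX1 // addr0 !add0r subrr.
  rewrite {1}/assignment /assign (negPf (yx0 _)) ffunE.
  rewrite tX1 // invg1 mulg1 mul1g; congr expgz.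
  rewrite /coef (bigD1 i) //= /basis eqxx val_Zp_nat // modn_small // eqxx mulr1.
  rewrite big1 ?addr0 // => i' ii'; case: ifP => [/andP[/eqP/y_inj i1 /eqP i2]|_].
    case/eqP: ii'; rewrite [i']surjective_pairing [i]surjective_pairing i1.
    by congr (_, _); apply/val_inj/esym; exact: addnI i2.
  by rewrite mulr0.
move=> _ [[] _ <-]; last first.
  exists (nseq n (x0, false)); rewrite word_eval_nseq ?tXn // tX.
  exact: pchar_Zp.
rewrite -[e true]/(expgz (e true) 1) -vb.
elim/big_rec: _ => [|i k _ Yk]; first exact: is_subgroup1.
rewrite expgzD; apply: is_subgroupM => //.
exact/YM/Yv.
Qed.

Lemma wreath_quotient : exists assign : A -> wreath Phi 'Z_n,
  (forall j, word_eval assign (rel j) = assign (y (lift ord0 j))) /\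
  (forall z, exists2 w, (word_eval assign w).2 = 0%R & (word_eval assign w).1 0%R = z).
Proof.
have [v [b [vP vb]]] := unimodular_kernel (fun (i : I) (j : J) =>
  exponent x0 (basis i) (rel j.1) (L + j.2)%N%:R -
  basis i (y (lift ord0 j.1)) (L + j.2)%N%:R)%R card_IJ.
by exists (assignment v); split; [exact: relation_holds|exact: onto vb].
Qed.

End BaumslagPride.

(** The order of the cyclic group is taken to be a power of 2 for the sake of
    residual nilpotence. *)
Lemma baumslag_pride (A : eqType) (x0 : A) (m : nat) (y : 'I_m.+1 -> A)
    (rel : 'I_m -> word A) (Phi : groupType) (e : bool -> Phi) :
  injective y -> (forall i, y i != x0) -> (forall j, commutator_word (rel j)) ->
  generated_subgroup (range e) = setT ->
  exists2 r, 0 < r & exists assign : A -> wreath Phi 'Z_(2 ^ r),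
    (forall j, word_eval assign (rel j) = assign (y (lift ord0 j))) /\
    (forall z, exists2 w, (word_eval assign w).2 = 0%R &
       (word_eval assign w).1 0%R = z).
Proof.
move=> y_inj yx0 relC eT; pose L := (\max_(j < m) size (rel j)).+1.
exists (L * (2 * m + 4)).+1 => //; apply: (@wreath_quotient _ _ _ _ y_inj yx0 _ relC _ _ eT L) => //.
  by move=> j; rewrite ltnS; exact: (leq_bigmax j).
by apply: leq_trans (ltn_expl _ _); rewrite // ltnS ltnW.
Qed.

(** * Largeness *)

(** On the preimage of the base group the coordinate at 0 is a homomorphism. *)
Lemma large_of_wreath (G Phi : groupType) (K : finZmodType)
    (psi : {multiplicative G -> wreath Phi K}) :
  is_free Phi -> ~ is_abelian Phi ->
  (forall z, exists2 g, (psi g).2 = 0%R & (psi g).1 0%R = z) ->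
  large G.
Proof.
move=> fPhi naPhi psiT; pose H : set G := [set g | (psi g).2 = 0%R].
have sH : is_subgroup H.
  apply/is_subgroupP; split=> [|x y x0 y0]; first by rewrite /H /mkset gmorph1.
  by rewrite /H /mkset gmulfM gmorphV wreath_shiftM wreath_shiftV x0 y0 subr0.
have [f fE] : exists f : {multiplicative subgroup_type sH -> Phi},
    f =1 fun h => (psi (val h)).1 0%R.
  apply: morphism_of => x y.
  have x0 : (psi (val x)).2 = 0%R by have := valP x; rewrite inE.
  by rewrite [val _]/(val x * val y) gmulfM wreathME x0 addr0.
exists H, sH, Phi, f; split=> //; last first.
  move=> z; have [g g0 gz] := psiT z.
  have gH : g \in H by rewrite inE.
  by exists (Sub g gH); rewrite fE SubK.
pose c (k : K) : set G := [set g | (psi g).2 = k].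
apply: (@sub_finite_set _ _ (c @` [set: K])); last first.
  apply: finite_image; exact: finite_finset.
move=> _ [x _ <-]; exists (psi x).2 => //.
rewrite eqEsubset; split=> [g gx|_ [h h0 <-]].
  exists (x^-1 * g); rewrite ?mulVKg //.
  by rewrite /H /mkset gmulfM gmorphV wreath_shiftM wreath_shiftV gx addNr.
by rewrite /c /mkset gmulfM wreath_shiftM h0 addr0.
Qed.

(** Mapping [F] to the subgroup generated by [X] and back is the identity on [X],
    hence on [F]. *)
Lemma free_on_generated (F : groupType) (X : set F) :
  free_on X -> generated_subgroup X = setT.
Proof.
move=> fX; set K := generated_subgroup X; have sK : is_subgroup K := generated_is_subgroup X.
have [[g gE] _] := fX (subgroup_type sK) (fun x => insubd 1 x).
have [g' g'E] : exists g' : {multiplicative F -> F}, g' =1 (fun x => val (g x)).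
  by apply: morphism_of => x y; rewrite gmulfM.
have [_ uniq_id] := fX F id.
rewrite eqEsubset; split=> // x _.
have -> : x = val (g x).
  rewrite -g'E; apply/esym/(uniq_id g' idfun) => // y Xy.
  rewrite g'E gE // val_insubd ifT // inE; exact: sub_gen_smallest.
by have := valP (g x); rewrite inE.
Qed.

Lemma finitely_presented_generated (G : groupType) : finitely_presented G ->
  exists m (y : 'I_m -> G), generated_subgroup (range y) = setT.
Proof.
move=> [F [X [R [fX /finite_seqP[s Xs] _ [f [f' fK f'K]]]]]].
pose p : {multiplicative F -> G} := f \o \pi_(group_quotient (normal_closure R)).
exists (size s), (fun i => p (tnth (in_tuple s) i)).
rewrite eqEsubset; split=> // g _; set K := generated_subgroup _.
suff Kp : forall x, K (p x).
  have := Kp (repr (f' g)); rewrite /p /= reprK f'K.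
  exact.
apply: (generated_eqT_ind (free_on_generated fX)).
  exact: (preimage_subgroup p (generated_is_subgroup _)).
rewrite Xs => x /= /(tnthP (in_tuple s))[i ->].
by apply: sub_gen_smallest; exists i.
Qed.

(** * Weakly parafree groups *)

(** Each isomorphism [phi i] is induced by a homomorphism F -> G, but the choice
    of lifts depends on [i]. All these homomorphisms agree modulo gamma_2, hence
    they induce the same maps between the graded pieces of the lower central
    series, and the first of them serves for all [i]. *)
Lemma weakly_parafree_morphism (G : groupType) : weakly_parafree G ->
  exists (F : groupType) (X : set F) (theta : {multiplicative F -> G}),
  [/\ free_on X, forall g, exists v, lcs G 2 ((theta v)^-1 * g) &
      forall i v, lcs G i.+1 (theta v) -> lcs F i.+1 v].
Proof.
move=> [F [[X fX] _ [phi [phi_bij phi_comp]]]].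
pose pF i : {multiplicative F -> _} := \pi_(group_quotient (gamma F i.+1)).
pose pG i : {multiplicative G -> _} := \pi_(group_quotient (gamma G i.+1)).
have lift i : exists th : {multiplicative F -> G},
    forall v, pG i (th v) = phi i (pF i v).
  have [[th thE] _] := fX G (fun x => repr (phi i (pF i x))).
  exists th; have [_ uq] := fX _ (fun x => phi i (pF i x)).
  apply: (uq (pG i \o th) (phi i \o pF i)) => // x Xx /=.
  by rewrite thE //; exact: reprK.
pose th i := projT1 (cid (lift i)).
have thE i v : pG i (th i v) = phi i (pF i v) by rewrite /th; case: cid.
have th1 i v : lcs G 2 ((th 1%N v)^-1 * th i.+1 v).
  elim: i => [|i IH]; first by rewrite mulVg; exact: (is_subgroup1 (@lcs_subgroup G 2)).
  suff : lcs G i.+2 ((th i.+1 v)^-1 * th i.+2 v).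
    by move=> /(lcs_leq (isT : 1 <= i.+1)) /(lcsM IH); rewrite -mulgA mulVKg.
  apply/quotient_eqP; rewrite -[LHS]/(pG i.+1 _) thE.
  have -> : pF i.+1 v = quotient_map (gamma F i.+3) (gamma F i.+2) (pF i.+2 v).
    by rewrite quotient_mapE //; exact: gamma_sub.
  rewrite phi_comp -thE quotient_mapE //; exact: gamma_sub.
exists F, X, (th 1%N); split=> // [g|i v].
  have [f _ fK] := phi_bij 1%N; exists (repr (f (pG 1%N g))).
  by apply/quotient_eqP; rewrite -[LHS]/(pG 1%N _) thE /pF /= reprK fK.
suff ind j : j <= i -> lcs G i.+1 (th 1%N v) -> lcs F j.+1 v by exact: ind.
elim: j => [//|j IH] ji gv; have gj := IH (ltnW ji) gv.
have := morphism_lcs_congr (th1 j) gj.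
move=> /(lcsM (lcs_leq ji gv)); rewrite mulVKg => gj1.
have : pG j.+1 (th j.+1 v) = 1 by apply/quotient_eq1.
rewrite thE => e1; apply/quotient_eq1; have [f fK _] := phi_bij j.+1.
by rewrite -[LHS]fK -[X in f X]/(phi j.+1 (pF j.+1 v)) e1 -(gmorph1 (phi j.+1)) fK.
Qed.

(** Otherwise the first homology group would be cyclic. *)
Lemma two_generators (F G : groupType) (X : set F) (theta : {multiplicative F -> G}) :
  generated_subgroup X = setT -> (forall g, exists v, lcs G 2 ((theta v)^-1 * g)) ->
  1 < b1 G -> exists x0 x1, [/\ X x0, X x1 & x0 != x1].
Proof.
move=> XT thT b1G; apply: contrapT => X1.
have [x Xx] : exists x, X `<=` [set x].
  have [[x Xx]|X0] := pselect (exists x, X x); last first.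
    by exists 1 => x Xx; case: X0; exists x.
  exists x => y Xy; apply: contrapT => /eqP yx; apply: X1.
  by exists y, x.
have FE v : exists z : int, v = expgz x z.
  apply: (generated_eqT_ind (K := [set v | exists z : int, v = expgz x z]) XT).
    apply/is_subgroupP; split=> [|_ _ [z ->] [w ->]]; first by exists 0%R.
    by exists (z - w)%R; rewrite expgzD expgzN.
  by move=> y /Xx ->; exists 1%R.
pose q (g : G) : homology1 G := \pi_(group_quotient (gamma G 2)) g.
have qM a b : q (a * b) = (q a + q b)%R by exact/esym/quotient_mulE.
have q1 : q 1 = 0%R by [].
have qV a : q a^-1 = (- q a)%R by exact/esym/quotient_invE.
have HE (a : homology1 G) : exists z : int, a = (q (theta x) *~ z)%R.
  elim/quotient_ind: a => g; have [v gv] := thT g; have [z vz] := FE v.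
  exists z; have -> : \pi_(group_quotient (gamma G 2)) g = q (theta v).
    by apply/esym/quotient_eqP.
  have qX k : q (theta x ^+ k) = (q (theta x) *+ k)%R.
    by elim: k => [|k IH]; rewrite ?mulr0n // expgS qM IH mulrS.
  rewrite vz; case: (z) => k /=.
    by rewrite -pmulrn -qX; congr q; elim: k {vz} => [|k IH]; rewrite ?gmorph1 // !expgS gmulfM IH.
  rewrite NegzE mulrNz -pmulrn -qX -qV gmorphV; congr (q _^-1).
  by elim: (k.+1) => [|l IH]; rewrite ?gmorph1 // !expgS gmulfM IH.
have [n n_gt1 [a ind]] : exists2 n, 1 < n & exists a : 'I_n -> homology1 G, Z_independent a.
  exists (b1 G) => //; move: b1G; rewrite /b1 /Z_rank.
  by case: xgetP => [y _ [ay _] _|]; rewrite ?ltn0.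
pose i0 : 'I_n := Ordinal (ltnW n_gt1); pose i1 : 'I_n := Ordinal n_gt1.
have [z0 a0] := HE (a i0); have [z1 a1] := HE (a i1).
pose c (u0 u1 : int) (i : 'I_n) : int := if i == i0 then u0 else if i == i1 then u1 else 0%R.
have cE u0 u1 : (\sum_i a i *~ c u0 u1 i)%R = (a i0 *~ u0 + a i1 *~ u1)%R.
  rewrite (bigD1 i0) //= (bigD1 i1) //= big1 ?addr0 => [|i /andP[/negPf ni0 /negPf ni1]].
    by rewrite /c.
  by rewrite /c ni0 ni1 mulr0z.
have /ind/(_ i0) : (\sum_i a i *~ c z1 (- z0) i = 0)%R.
  by rewrite cE a0 a1 -!mulrzA mulrN mulrNz [(z1 * _)%R]mulrC subrr.
rewrite /c eqxx => z10; have : a i1 = 0%R by rewrite a1 z10 mulr0z.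
move=> a10; have /ind/(_ i1) : (\sum_i a i *~ c 0 1 i = 0)%R.
  by rewrite cE a10 mulr0z mul0rz addr0.
by rewrite /c.
Qed.

(** * Homomorphisms out of weakly parafree groups *)

(** Modulo gamma_(i+1)(E) an element [e] of the kernel of [p1] comes from some
    [v] in F, whose image in G is then in gamma_(i+1)(G); so [v] is in
    gamma_(i+1)(F), and [p2 e] in gamma_(i+1)(W). *)
Lemma parafree_kernel_sub (F G W E : groupType) (theta : {multiplicative F -> G})
    (h : {multiplicative F -> E}) (p1 : {multiplicative E -> G})
    (p2 : {multiplicative E -> W}) :
  (forall v, p1 (h v) = theta v) ->
  (forall i v, lcs G i.+1 (theta v) -> lcs F i.+1 v) ->
  (forall e, exists v, lcs E 2 ((h v)^-1 * e)) ->
  (forall w : W, (forall i, lcs W i.+1 w) -> w = 1) ->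
  forall e, p1 e = 1 -> p2 e = 1.
Proof.
move=> p1h thI hE W1 e p1e; apply: W1 => i.
have [v ve] := generates_mod_lcs hE i e.
have := morphism_lcs p1 ve; rewrite gmulfM gmorphV p1e mulg1 p1h => /lcsV.
rewrite invgK => /thI /(morphism_lcs h)/lcsM/(_ ve).
by rewrite mulVKg => /(morphism_lcs p2).
Qed.

(** A group generated by the image of a free group F and by further elements that
    are products of commutators is, up to its nilpotent residual, determined by
    the relations that express these elements. The subgroup E of G x W generated
    by the pairs (eG a, f a) equals h(F) gamma_2(E), where h : F -> E lifts
    [theta], because its remaining generators are products of commutators. *)
Lemma parafree_extension (F G W : groupType) (X : set F) (J : Type)
    (A := ({x : F | x \in X} + J)%type) (theta : {multiplicative F -> G})
    (eG : A -> G) (rel : J -> word A) (f : A -> W) :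
  free_on X ->
  (forall i v, lcs G i.+1 (theta v) -> lcs F i.+1 v) ->
  generated_subgroup (range eG) = setT ->
  (forall x, eG (inl x) = theta (val x)) ->
  (forall j, commutator_word (rel j)) ->
  (forall j, word_eval eG (rel j) = eG (inr j)) ->
  (forall j, word_eval f (rel j) = f (inr j)) ->
  (forall w : W, (forall i, lcs W i.+1 w) -> w = 1) ->
  exists psi : {multiplicative G -> W}, forall a, psi (eG a) = f a.
Proof.
move=> fX thI eGT eGX relC relG relW W1.
pose d (a : A) : G * W := (eG a, f a).
set S := generated_subgroup (range d).
pose sS : is_subgroup S := generated_is_subgroup _.
have [d' dE dT] := subgroup_type_generated d.
set E := subgroup_type sS.
have [p1 p1E] : exists p : {multiplicative E -> G}, p =1 fun e => (val e).1.
  by apply: morphism_of.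
have [p2 p2E] : exists p : {multiplicative E -> W}, p =1 fun e => (val e).2.
  by apply: morphism_of.
have [[h hX] _] := fX E (fun x => if insub x is Some x' then d' (inl x') else 1).
have {}hX x : h (val x) = d' (inl x).
  by rewrite hX; [rewrite valK|have := valP x; rewrite inE].
have p1h x : p1 (h x) = theta x.
  have [_ uq] := fX G theta; apply: (uq (p1 \o h) theta) => // {}x Xx /=.
  have -> : x = val (exist (fun x => x \in X) x (mem_set Xx)) by [].
  by rewrite hX p1E dE /= eGX.
have p1d : p1 \o d' = eG by apply: funext => a /=; rewrite p1E dE.
have p2d : p2 \o d' = f by apply: funext => a /=; rewrite p2E dE.
have d'R j : d' (inr j) = word_eval d' (rel j).
  apply: val_inj; rewrite dE /d -relG -relW.
  rewrite -[in X in (X, _)]p1d -[in X in (_, X)]p2d -!morphism_word_eval.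
  by rewrite p1E p2E -surjective_pairing.
have hE e : exists x, lcs E 2 ((h x)^-1 * e).
  pose K : set E := [set e | exists x, lcs E 2 ((h x)^-1 * e)].
  apply: (generated_eqT_ind (K := K) dT).
    pose pi : {multiplicative E -> _} := \pi_(group_quotient (gamma E 2)).
    have KE x e' : lcs E 2 ((h x)^-1 * e') <-> pi (h x) = pi e'.
      by split=> [?|?]; apply/quotient_eqP.
    apply/is_subgroupP; split=> [|e1 e2 [z1 /KE e1E] [z2 /KE e2E]].
      by exists 1; apply/KE; rewrite gmorph1.
    by exists (z1 / z2); apply/KE; rewrite !gmulfM !gmorphV e1E e2E.
  move=> _ [[x|j] _ <-].
    by exists (val x); rewrite hX mulVg; exact: (is_subgroup1 (@lcs_subgroup _ 2)).
  exists 1; rewrite gmorph1 invg1 mul1g d'R; exact: commutator_word_lcs.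
have [||psi psiE] := graph_morphism sS.
- move=> z; have [w <-] : exists w, word_eval eG w = z.
    by apply: generated_words; rewrite eGT.
  exists (word_eval d w).2.
  rewrite (_ : (_, _) = word_eval d w).
    by apply: (word_eval_closed w sS) => a; apply: sub_gen_smallest; exists a.
  by rewrite [RHS]surjective_pairing; congr (_, _); rewrite morphism_word_eval.
- move=> w Sw; have Sw' : (1, w) \in S by exact: mem_set.
  have := @parafree_kernel_sub _ _ _ _ _ _ _ p2 p1h thI hE W1 (Sub (1, w) Sw').
  by rewrite p1E p2E SubK; apply.
by exists psi => a; apply/psiE; apply: sub_gen_smallest; exists a.
Qed.

(** Two basis elements [x0], [x1] of F play different roles: [x0] becomes the
    cyclic direction, and [x1] provides one unknown vector more than there are
    relations. *)
Lemma large_of_weakly_parafree (G : groupType) m (g : 'I_m -> G) :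
  generated_subgroup (range g) = setT -> weakly_parafree G -> (1 < b1 G)%N ->
  large G.
Proof.
move=> gT /weakly_parafree_morphism[F [X [theta [fX thT thI]]]] b1G.
have XT := free_on_generated fX.
have [x0 [x1 [/mem_set Xx0 /mem_set Xx1 x01]]] := two_generators XT thT b1G.
pose A : eqType := ({x : F | x \in X} + 'I_m)%type.
(* correcting the generators by theta(F) makes them products of commutators *)
have [v vE] : exists v, forall j, lcs G 2 ((theta (v j))^-1 * g j).
  by exists (fun j => projT1 (cid (thT (g j)))) => j; case: cid.
pose eG (a : A) : G :=
  match a with inl x => theta (val x) | inr j => (theta (v j))^-1 * g j end.
have eGT : generated_subgroup (range eG) = setT.
  rewrite eqEsubset; split=> // z _; set K := generated_subgroup _.
  have sK : is_subgroup K by exact: generated_is_subgroup.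
  have Kth : forall x, K (theta x).
    apply: (generated_eqT_ind XT (preimage_subgroup theta sK)) => x Xx.
    by apply: sub_gen_smallest; exists (inl (exist _ x (mem_set Xx))).
  apply: (generated_eqT_ind gT sK) => _ [j _ <-].
  rewrite -(mulVKg (theta (v j)) (g j)); apply: (is_subgroupM sK) => //.
  by apply: sub_gen_smallest; exists (inr j).
pose rel j := projT1 (cid2 (lcs_commutator_word eGT (vE j))).
have relC j : commutator_word (rel j) by rewrite /rel; case: cid2.
have relG j : word_eval eG (rel j) = eG (inr j) by rewrite /rel; case: cid2.
pose a0 : A := inl (exist _ x0 Xx0).
pose y (i : 'I_m.+1) : A :=
  if unlift ord0 i is Some j then inr j else inl (exist _ x1 Xx1).
have y_inj : injective y.
  move=> i j; rewrite /y; case: unliftP => [i'|] ->; case: unliftP => [j'|] -> //.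
  by move=> [->].
have ya0 i : y i != a0.
  rewrite /y; case: unliftP => [i'|] _ //; apply/eqP => -[/esym e].
  by rewrite e eqxx in x01.
have [eS fS eST] := sanov_basis.
have [r r_gt0 [f [fR fT]]] := baumslag_pride y_inj ya0 relC eST.
have {}fR j : word_eval f (rel j) = f (inr j) by rewrite fR /y liftK.
have [psi psiE] := parafree_extension fX thI eGT (fun=> erefl) relC relG fR
  (fun w => sanov_wreath_residually_nilpotent r_gt0).
apply: (large_of_wreath (psi := psi)).
- by exists (range eS).
- exact: sanov_nonabelian.
move=> z; have [w w2 wz] := fT z; exists (word_eval eG w);
  by rewrite morphism_word_eval (_ : psi \o eG = f) //; apply: funext.
Qed.

Theorem theorem1p3 (G : groupType) :
  finitely_presented G -> weakly_parafree G -> (1 < b1 G)%N -> large G.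
Proof.
move=> /finitely_presented_generated[m [g gT]].
exact: large_of_weakly_parafree gT.
Qed.
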